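(* (1) For all $\Sigma_1$ formulas $A(\mathbf x)$ and $B(\mathbf x)$, if $\mathbf I\Sigma_1\vdash A(\mathbf x)\to B(\mathbf x)$ (as a classical theory, i.e. proves the universal closure), then $\mathbf{EBA}\vdash A(\mathbf x)\Rightarrow B(\mathbf x)$. (2) For all $\Delta_0$ formulas $A(\mathbf x)$ and $B(\mathbf x)$, if $\mathbf{PA}\vdash A(\mathbf x)\to B(\mathbf x)$, then $\mathbf{EBA}\vdash A(\mathbf x)\Rightarrow B(\mathbf x)$.
   Context: Basic Arithmetic $\mathbf{BA}$ (Ruitenburg) is the following theory of sequents $A\Rightarrow B$ in the language $\{0,S,+,\cdot\}$, where formulas are built from atomic formulas ($s=t$, $\top$, $\bot$) by $\land,\lor,\exists x$ and the former $\forall\mathbf x(A\to B)$ ($\mathbf x$ a finite, possibly empty, sequence of variables; empty gives $A\to B$). Logical part (Basic Predicate Calculus): axioms $A\Rightarrow A$; $A\Rightarrow\top$; $\bot\Rightarrow A$; $A\land(B\lor C)\Rightarrow(A\land B)\lor(A\land C)$; $A\land\exists xB\Rightarrow\exists x(A\land B)$ ($x$ not free in $A$); $\top\Rightarrow x=x$; $x=y\land A\Rightarrow A[x/y]$ ($A$ atomic); $\forall\mathbf x(A\to B)\land\forall\mathbf x(B\to C)\Rightarrow\forall\mathbf x(A\to C)$; $\forall\mathbf x(A\to B)\land\forall\mathbf x(A\to C)\Rightarrow\forall\mathbf x(A\to B\land C)$; $\forall\mathbf x(B\to A)\land\forall\mathbf x(C\to A)\Rightarrow\forall\mathbf x(B\lor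 C\to A)$; $\forall\mathbf x(A\to B)\Rightarrow\forall\mathbf x(A[\mathbf x/\mathbf t]\to B[\mathbf x/\mathbf t])$; $\forall\mathbf x(A\to B)\Rightarrow\forall\mathbf y(A\to B)$ (no variable of $\mathbf y$ free on the left); $\forall\mathbf yx(B\to A)\Rightarrow\forall\mathbf y(\exists xB\to A)$ ($x$ not free in $A$); rules: transitivity; $A\Rightarrow B\land C$ iff $A\Rightarrow B$ and $A\Rightarrow C$; $B\lor C\Rightarrow A$ iff $B\Rightarrow A$ and $C\Rightarrow A$; term substitution; $\exists xB\Rightarrow A$ iff $B\Rightarrow A$ ($x$ not free in $A$); from $A\land B\Rightarrow C$ infer $A\Rightarrow\forall\mathbf x(B\to C)$ (no variable of $\mathbf x$ free in $A$). Arithmetic part: $Sx=0\Rightarrow\bot$; $Sx=Sy\Rightarrow x=y$; $x+0=x$; $x+Sy=S(x+y)$; $x\cdot0=0$; $x\cdot Sy=x\cdot y+x$; induction axiom schema $\forall\mathbf yx(A\to A[x/Sx])\Rightarrow\forall\mathbf yx(A[x/0]\to A)$; induction rule: from $A\Rightarrow A[x/Sx]$ infer $A[x/0]\Rightarrow A$. $\mathbf{EBA}$ is $\mathbf{BA}$ plus the sequent $(\top\to\bot)\Rightarrow\bot$. $s<t$ abbreviates $\exists z(s+Sz=t)$. $\Delta_0$: smallest class containing atomic formulas, closed under $\land,\lor,\to$ and bounded quantifiers $\exists x(x<s\land A)$, $\forall x(x<s\to A)$ (these are formulas of both basic and classical logic); $\Sigma_1$: $\exists\mathbf xA$ with $A\in\Delta_0$.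 $\mathbf I\Sigma_1$ is the classical theory consisting of Robinson's $\mathbf Q$ ($Sx\ne0$; $Sx=Sy\to x=y$; $x+0=x$; $x+Sy=S(x+y)$; $x\cdot0=0$; $x\cdot Sy=x\cdot y+x$; $x=0\lor\exists y(x=Sy)$) plus induction for $\Sigma_1$ formulas; $\mathbf{PA}$ is classical Peano arithmetic. *)

(* Defs.v *)
From Stdlib Require Import List Arith.
Import ListNotations.

(** * Terms and formulas

    Variables are de Bruijn indices: under [k] binders, index [i < k] is bound
    and index [k + j] denotes the free variable [j].  Alpha-equivalent formulas
    are thereby identified and substitution is capture-avoiding. *)

Inductive term : Type :=
| Var (x : nat)
| Zero
| Succ (t : term)
| Add (s t : term)
| Mul (s t : term).

(** [All n A B] is the primitive former [forall x_1 ... x_n (A -> B)]; it binds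
    the indices [0, ..., n-1] in both [A] and [B], and [n = 0] is allowed. *)
Inductive form : Type :=
| Top
| Bot
| Eq (s t : term)
| And (A B : form)
| Or (A B : form)
| Ex (A : form)
| All (n : nat) (A B : form).

Definition Imp (A B : form) : form := All 0 A B.
Definition Neg (A : form) : form := Imp A Bot.

Fixpoint tsubst (f : nat -> term) (t : term) : term :=
  match t with
  | Var x => f x
  | Zero => Zero
  | Succ t => Succ (tsubst f t)
  | Add s t => Add (tsubst f s) (tsubst f t)
  | Mul s t => Mul (tsubst f s) (tsubst f t)
  end.

Definition tlift (n : nat) : term -> term := tsubst (fun x => Var (n + x)).

(** The substitution [f] carried under [n] binders. *)
Definition up (n : nat) (f : nat -> term) : nat -> term :=
  fun x => if x <? n then Var x else tlift n (f (x - n)).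

Fixpoint subst (f : nat -> term) (A : form) : form :=
  match A with
  | Top => Top
  | Bot => Bot
  | Eq s t => Eq (tsubst f s) (tsubst f t)
  | And A B => And (subst f A) (subst f B)
  | Or A B => Or (subst f A) (subst f B)
  | Ex A => Ex (subst (up 1 f) A)
  | All n A B => All n (subst (up n f) A) (subst (up n f) B)
  end.

(** Carries [A] into the scope of [n] additional binders; [lift n A] is an
    arbitrary formula in which none of the [n] bound variables is free. *)
Definition lift (n : nat) : form -> form := subst (fun x => Var (n + x)).

Definition rename (r : nat -> nat) : form -> form := subst (fun x => Var (r x)).

(** [replace x t A] is [A[x/t]], the variable [x] itself staying in scope. *)
Definition replace (x : nat) (t : term) : form -> form :=
  subst (fun y => if y =? x then t else Var y).

(** [replace_block n ts A] is [A[x_1,...,x_n / t_1,...,t_n]], simultaneously for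
    the [n] innermost variables, which stay in scope. *)
Definition replace_block (n : nat) (ts : nat -> term) : form -> form :=
  subst (fun y => if y <? n then ts y else Var y).

(** [inst_block n ts A] removes a block of [n] binders over [A], putting the
    terms [ts] for the bound variables. *)
Definition inst_block (n : nat) (ts : nat -> term) : form -> form :=
  subst (fun y => if y <? n then ts y else Var (y - n)).

Definition inst (t : term) : form -> form := inst_block 1 (fun _ => t).

Definition Lt (s t : term) : form :=
  Ex (Eq (Add (tlift 1 s) (Succ (Var 0))) (tlift 1 t)).

Inductive atomic : form -> Prop :=
| atomic_Top : atomic Top
| atomic_Bot : atomic Bot
| atomic_Eq s t : atomic (Eq s t).

(** In the bounded quantifiers, the lift says that the quantified variable does
    not occur in the bound [s]. *)
Inductive Delta0 : form -> Prop :=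
| Delta0_atomic A : atomic A -> Delta0 A
| Delta0_And A B : Delta0 A -> Delta0 B -> Delta0 (And A B)
| Delta0_Or A B : Delta0 A -> Delta0 B -> Delta0 (Or A B)
| Delta0_Imp A B : Delta0 A -> Delta0 B -> Delta0 (Imp A B)
| Delta0_Ex s A : Delta0 A -> Delta0 (Ex (And (Lt (Var 0) (tlift 1 s)) A))
| Delta0_All s A : Delta0 A -> Delta0 (All 1 (Lt (Var 0) (tlift 1 s)) A).

Inductive Sigma1 : form -> Prop :=
| Sigma1_Delta0 A : Delta0 A -> Sigma1 A
| Sigma1_Ex A : Sigma1 A -> Sigma1 (Ex A).

(** * Basic Arithmetic

    [BA_with X A B]: the sequent [A => B] is derivable in Basic Arithmetic
    extended by the sequents in [X]. *)

Inductive BA_with (X : form -> form -> Prop) : form -> form -> Prop :=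
| ba_extra A B : X A B -> BA_with X A B
(* Basic Predicate Calculus: axioms *)
| ba_id A : BA_with X A A
| ba_top A : BA_with X A Top
| ba_bot A : BA_with X Bot A
| ba_and_or A B C : BA_with X (And A (Or B C)) (Or (And A B) (And A C))
| ba_and_ex A B : BA_with X (And A (Ex B)) (Ex (And (lift 1 A) B))
| ba_refl x : BA_with X Top (Eq (Var x) (Var x))
| ba_eq x y A : atomic A ->
    BA_with X (And (Eq (Var x) (Var y)) A) (replace x (Var y) A)
| ba_all_trans n A B C :
    BA_with X (And (All n A B) (All n B C)) (All n A C)
| ba_all_and n A B C :
    BA_with X (And (All n A B) (All n A C)) (All n A (And B C))
| ba_all_or n A B C :
    BA_with X (And (All n B A) (All n C A)) (All n (Or B C) A)
| ba_all_subst n ts A B :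
    BA_with X (All n A B) (All n (replace_block n ts A) (replace_block n ts B))
(* Passage from the block x = x_1,...,x_n to a block y of m variables none of
   which is free on the left: variables free on the left keep their meaning,
   and r places each x_i in y, or among the free variables if y omits it. *)
| ba_all_block n m r A B : (forall k, r (n + k) = m + k) ->
    BA_with X (All n A B) (All m (rename r A) (rename r B))
| ba_all_ex n A B :
    BA_with X (All (S n) B (lift 1 A)) (All n (Ex B) A)
(* Basic Predicate Calculus: rules *)
| ba_trans A B C : BA_with X A B -> BA_with X B C -> BA_with X A C
| ba_and_intro A B C :
    BA_with X A B -> BA_with X A C -> BA_with X A (And B C)
| ba_and_elim1 A B C : BA_with X A (And B C) -> BA_with X A B
| ba_and_elim2 A B C : BA_with X A (And B C) -> BA_with X A C
| ba_or_elim A B C :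
    BA_with X B A -> BA_with X C A -> BA_with X (Or B C) A
| ba_or_intro1 A B C : BA_with X (Or B C) A -> BA_with X B A
| ba_or_intro2 A B C : BA_with X (Or B C) A -> BA_with X C A
| ba_subst f A B : BA_with X A B -> BA_with X (subst f A) (subst f B)
| ba_ex_elim A B : BA_with X B (lift 1 A) -> BA_with X (Ex B) A
| ba_ex_intro A B : BA_with X (Ex B) A -> BA_with X B (lift 1 A)
| ba_all_intro n A B C :
    BA_with X (And (lift n A) B) C -> BA_with X A (All n B C)
(* Arithmetic *)
| ba_succ_zero x : BA_with X (Eq (Succ (Var x)) Zero) Bot
| ba_succ_inj x y :
    BA_with X (Eq (Succ (Var x)) (Succ (Var y))) (Eq (Var x) (Var y))
| ba_add_zero x : BA_with X Top (Eq (Add (Var x) Zero) (Var x))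
| ba_add_succ x y :
    BA_with X Top (Eq (Add (Var x) (Succ (Var y))) (Succ (Add (Var x) (Var y))))
| ba_mul_zero x : BA_with X Top (Eq (Mul (Var x) Zero) Zero)
| ba_mul_succ x y :
    BA_with X Top
      (Eq (Mul (Var x) (Succ (Var y))) (Add (Mul (Var x) (Var y)) (Var x)))
(* The induction variable is the last, that is innermost, one of the block. *)
| ba_ind_axiom n A :
    BA_with X (All (S n) A (replace 0 (Succ (Var 0)) A))
              (All (S n) (replace 0 Zero A) A)
| ba_ind_rule x A :
    BA_with X A (replace x (Succ (Var x)) A) -> BA_with X (replace x Zero A) A.

Definition BA : form -> form -> Prop := BA_with (fun _ _ => False).

Definition EBA : form -> form -> Prop :=
  BA_with (fun A B => A = Imp Top Bot /\ B = Bot).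

(** * Classical theories

    Classical first-order logic on the same formulas, in natural deduction; the
    classical [forall x A] is [All 1 Top A].  The axioms in [T] are not lifted
    when a binder is introduced, so that an open axiom stands for its universal
    closure; likewise [proves T [] A] holds for an open [A] exactly when it
    holds for the universal closure of [A]. *)

Inductive proves (T : form -> Prop) : list form -> form -> Prop :=
| c_axiom G A : T A -> proves T G A
| c_hyp G A : In A G -> proves T G A
| c_raa G A : proves T (Neg A :: G) Bot -> proves T G A
| c_top_intro G : proves T G Top
| c_and_intro G A B : proves T G A -> proves T G B -> proves T G (And A B)
| c_and_elim1 G A B : proves T G (And A B) -> proves T G A
| c_and_elim2 G A B : proves T G (And A B) -> proves T G B
| c_or_intro1 G A B : proves T G A -> proves T G (Or A B)
| c_or_intro2 G A B : proves T G B -> proves T G (Or A B)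
| c_or_elim G A B C : proves T G (Or A B) ->
    proves T (A :: G) C -> proves T (B :: G) C -> proves T G C
| c_ex_intro G A t : proves T G (inst t A) -> proves T G (Ex A)
| c_ex_elim G A C : proves T G (Ex A) ->
    proves T (A :: map (lift 1) G) (lift 1 C) -> proves T G C
| c_all_intro G n A B :
    proves T (A :: map (lift n) G) B -> proves T G (All n A B)
| c_all_elim G n ts A B : proves T G (All n A B) ->
    proves T G (inst_block n ts A) -> proves T G (inst_block n ts B)
| c_eq_refl G t : proves T G (Eq t t)
| c_eq_elim G s t A : proves T G (Eq s t) ->
    proves T G (inst s A) -> proves T G (inst t A).

Inductive Q : form -> Prop :=
| Q_succ_zero x : Q (Neg (Eq (Succ (Var x)) Zero))
| Q_succ_inj x y :
    Q (Imp (Eq (Succ (Var x)) (Succ (Var y))) (Eq (Var x) (Var y)))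
| Q_add_zero x : Q (Eq (Add (Var x) Zero) (Var x))
| Q_add_succ x y :
    Q (Eq (Add (Var x) (Succ (Var y))) (Succ (Add (Var x) (Var y))))
| Q_mul_zero x : Q (Eq (Mul (Var x) Zero) Zero)
| Q_mul_succ x y :
    Q (Eq (Mul (Var x) (Succ (Var y))) (Add (Mul (Var x) (Var y)) (Var x)))
| Q_pred x :
    Q (Or (Eq (Var x) Zero) (Ex (Eq (Var (S x)) (Succ (Var 0))))).

(** The induction variable of [A] is index [0]; all others are parameters. *)
Definition induction (A : form) : form :=
  Imp (And (inst Zero A) (All 1 A (replace 0 (Succ (Var 0)) A)))
      (All 1 Top A).

Inductive ISigma1 : form -> Prop :=
| ISigma1_of_Q A : Q A -> ISigma1 A
| ISigma1_induction A : Sigma1 A -> ISigma1 (induction A).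

Inductive PA : form -> Prop :=
| PA_of_Q A : Q A -> PA A
| PA_induction A : PA (induction A).

(* Main.v *)
(** Modus ponens in Basic logic only yields [Top -> B] from [A] and [A -> B].
    Call [B] stable when [(Top -> B) => B]; for stable formulas modus ponens is
    available.  In EBA the formula [Bot] is stable, hence so is every formula of
    the negative fragment, and the negative translation of PA is derivable: its
    induction axioms are instances of the induction axiom of BA.  The induction
    rule shows that EBA decides every [Delta0] formula, so that these agree with
    their negative translations, which gives (2).

    For (1), let [(C, D)] force a [Sigma1] formula [A] when EBA proves
    [C => A \/ D].  This extends to a weak forcing relation on all formulas,
    sound for classical logic.  The induction rule applied to
    [C /\ (A \/ D)] shows that [Sigma1] induction is forced.  If ISigma1 proves
    [A -> B], then [(A, B)], which forces [A], forces [B], that is,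
    EBA proves [A => B \/ B]. *)

From Stdlib Require Import List Arith Lia FunctionalExtensionality.
Import ListNotations.
Require Import Defs.

(** * Substitutions *)

Definition tcomp (f g : nat -> term) : nat -> term := fun x => tsubst f (g x).

Definition shift (n : nat) : nat -> term := fun x => Var (n + x).

(** One operation serves both to extend an assignment by values for a block of bound variables and,
    with [f] equal to [Var], to instantiate the block as in [inst_block]. *)
Definition env_app (n : nat) (ts f : nat -> term) : nat -> term :=
  fun x => if x <? n then ts x else f (x - n).

Lemma tsubst_comp f g t : tsubst f (tsubst g t) = tsubst (tcomp f g) t.
Proof. induction t; simpl; [reflexivity|congruence..]. Qed.

Lemma tsubst_Var t : tsubst Var t = t.
Proof. induction t; simpl; congruence. Qed.

Ltac ltb_cases :=
  repeat match goal with
  | |- context [?a <? ?b] => destruct (Nat.ltb_spec a b)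
  | |- context [?a =? ?b] => destruct (Nat.eqb_spec a b)
  end.

Lemma tcomp_assoc f g h : tcomp f (tcomp g h) = tcomp (tcomp f g) h.
Proof. extensionality x. apply tsubst_comp. Qed.

Lemma tcomp_Var_l f : tcomp Var f = f.
Proof. extensionality x. apply tsubst_Var. Qed.

Lemma tcomp_env_app n ts f g :
  tcomp g (env_app n ts f) = env_app n (tcomp g ts) (tcomp g f).
Proof. extensionality x. unfold tcomp, env_app. now ltb_cases. Qed.

Lemma env_app_0 ts f : env_app 0 ts f = f.
Proof. extensionality x. unfold env_app. simpl. now rewrite Nat.sub_0_r. Qed.

Lemma env_app_shift n ts f : tcomp (env_app n ts f) (shift n) = f.
Proof.
  extensionality x. unfold tcomp, env_app, shift. simpl. ltb_cases; [lia|].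
  f_equal. lia.
Qed.

(** Below [n] both sides read [ts]; beyond, the lift inside [up] is cancelled by [env_app_shift].
    Since [up] is itself an [env_app], composition under binders follows. *)
Lemma env_app_up n ts f h :
  tcomp (env_app n ts f) (up n h) = env_app n ts (tcomp f h).
Proof.
  extensionality x. unfold tcomp, up, env_app at 2. ltb_cases.
  - simpl. unfold env_app. ltb_cases; [reflexivity|lia].
  - unfold tlift. rewrite tsubst_comp. f_equal. apply (env_app_shift n ts f).
Qed.

Lemma up_env_app n f : up n f = env_app n Var (tcomp (shift n) f).
Proof. reflexivity. Qed.

Lemma up_comp n f g : tcomp (up n f) (up n g) = up n (tcomp f g).
Proof. now rewrite (up_env_app n f), env_app_up, <- tcomp_assoc. Qed.

Lemma up_Var n : up n Var = Var.
Proof.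
  extensionality x. unfold up, tlift. simpl. ltb_cases; f_equal. lia.
Qed.

Lemma up_0 f : up 0 f = f.
Proof. rewrite up_env_app, env_app_0. apply tcomp_Var_l. Qed.

Lemma subst_Imp f A B : subst f (Imp A B) = Imp (subst f A) (subst f B).
Proof. unfold Imp. simpl. now rewrite up_0. Qed.

Lemma subst_Neg f A : subst f (Neg A) = Neg (subst f A).
Proof. apply subst_Imp. Qed.

Lemma subst_comp A : forall f g, subst f (subst g A) = subst (tcomp f g) A.
Proof.
  induction A; intros f g; simpl; rewrite ?tsubst_comp; try congruence.
  - now rewrite IHA, up_comp.
  - now rewrite IHA1, IHA2, up_comp.
Qed.

Lemma subst_Var A : subst Var A = A.
Proof. induction A; simpl; rewrite ?tsubst_Var, ?up_Var; congruence. Qed.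

Lemma inst_block_env n ts A : inst_block n ts A = subst (env_app n ts Var) A.
Proof. reflexivity. Qed.

Lemma inst_env t A : inst t A = subst (env_app 1 (fun _ => t) Var) A.
Proof. reflexivity. Qed.

Lemma lift_shift n A : lift n A = subst (shift n) A.
Proof. reflexivity. Qed.

Lemma tlift_shift n t : tlift n t = tsubst (shift n) t.
Proof. reflexivity. Qed.

Lemma shift_up n f : tcomp (up n f) (shift n) = tcomp (shift n) f.
Proof. now rewrite up_env_app, env_app_shift. Qed.

Lemma inst_block_lift n ts A : inst_block n ts (lift n A) = A.
Proof.
  rewrite inst_block_env, lift_shift, subst_comp, env_app_shift.
  apply subst_Var.
Qed.

Lemma tsubst_tlift n f t : tsubst (up n f) (tlift n t) = tlift n (tsubst f t).
Proof. now rewrite !tlift_shift, !tsubst_comp, shift_up. Qed.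

Lemma subst_inst_block n ts f A :
  subst f (inst_block n ts A) = inst_block n (tcomp f ts) (subst (up n f) A).
Proof.
  rewrite !inst_block_env, !subst_comp, env_app_up, tcomp_env_app.
  now rewrite tcomp_Var_l.
Qed.

Lemma subst_Lt f s t : subst f (Lt s t) = Lt (tsubst f s) (tsubst f t).
Proof. unfold Lt. simpl. now rewrite !tsubst_tlift. Qed.

(** The renaming [up 1 (shift 1)] is what lifting [Ex A] leaves under its binder; the new free
    variable can then serve as witness. *)
Lemma inst_Var0 A : inst (Var 0) (subst (up 1 (shift 1)) A) = A.
Proof.
  rewrite inst_env, subst_comp, env_app_up.
  rewrite <- (subst_Var A) at 2. f_equal. extensionality x.
  unfold env_app. destruct x; simpl; [reflexivity|].
  unfold tcomp, shift. simpl. now rewrite Nat.sub_0_r.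
Qed.

(** * Sequents of EBA with a list of hypotheses *)

Definition Conj (G : list form) : form := fold_right And Top G.

Definition ent (G : list form) (A : form) : Prop := EBA (Conj G) A.

Lemma lift_conj n G : lift n (Conj G) = Conj (map (lift n) G).
Proof.
  induction G; simpl; [reflexivity|]. rewrite <- IHG. reflexivity.
Qed.

Lemma and_fst A B : EBA (And A B) A.
Proof. eapply ba_and_elim1, ba_id. Qed.

Lemma and_snd A B : EBA (And A B) B.
Proof. eapply ba_and_elim2, ba_id. Qed.

Lemma ent_hyp G A : In A G -> ent G A.
Proof.
  induction G as [|B G IH]; simpl; [easy|]. intros [->|H].
  - apply and_fst.
  - eapply ba_trans; [apply and_snd|]. now apply IH.
Qed.

Lemma ent_conj G H : (forall B, In B H -> ent G B) -> ent G (Conj H).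
Proof.
  induction H as [|B H IH]; simpl; intros HB.
  - apply ba_top.
  - apply ba_and_intro; [apply HB; auto|]. apply IH. auto.
Qed.

Lemma ent_weaken G H A : incl G H -> ent G A -> ent H A.
Proof.
  intros HG HA. eapply ba_trans; [|exact HA]. apply ent_conj.
  intros B HB. apply ent_hyp. auto.
Qed.

Lemma ent_seq G A B : EBA A B -> ent G A -> ent G B.
Proof. intros H1 H2. now apply (ba_trans _ _ _ _ H2). Qed.

Lemma ent_thm G A : EBA Top A -> ent G A.
Proof. intros H. now apply (ba_trans _ _ Top); [apply ba_top|]. Qed.

Lemma ent_cut G A B : ent G A -> ent (A :: G) B -> ent G B.
Proof.
  intros HA HB. eapply ba_trans; [|exact HB]. apply ba_and_intro; [exact HA|].
  apply ba_id.
Qed.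

Lemma seq_ent A B : ent [A] B -> EBA A B.
Proof.
  intros H. eapply ba_trans; [|exact H].
  apply ba_and_intro; [apply ba_id|apply ba_top].
Qed.

Lemma ent_and G A B : ent G A -> ent G B -> ent G (And A B).
Proof. apply ba_and_intro. Qed.

Lemma ent_and1 G A B : ent G (And A B) -> ent G A.
Proof. apply ba_and_elim1. Qed.

Lemma ent_and2 G A B : ent G (And A B) -> ent G B.
Proof. apply ba_and_elim2. Qed.

Lemma ent_or1 G A B : ent G A -> ent G (Or A B).
Proof. apply ent_seq. eapply ba_or_intro1, ba_id. Qed.

Lemma ent_or2 G A B : ent G B -> ent G (Or A B).
Proof. apply ent_seq. eapply ba_or_intro2, ba_id. Qed.

Lemma and_comm A B : EBA (And A B) (And B A).
Proof. apply ba_and_intro; [apply and_snd|apply and_fst]. Qed.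

Lemma ent_or_elim G A B C :
  ent G (Or A B) -> ent (A :: G) C -> ent (B :: G) C -> ent G C.
Proof.
  intros H HA HB. eapply ba_trans.
  - apply ba_and_intro; [apply ba_id|exact H].
  - eapply ba_trans; [apply ba_and_or|].
    apply ba_or_elim; (eapply ba_trans; [apply and_comm|assumption]).
Qed.

Lemma ent_bot G A : ent G Bot -> ent G A.
Proof. apply ent_seq, ba_bot. Qed.

Lemma ex_intro_seq t A : EBA (inst t A) (Ex A).
Proof.
  rewrite <- (inst_block_lift 1 (fun _ => t) (Ex A)).
  apply ba_subst, ba_ex_intro, ba_id.
Qed.

Lemma ent_ex G t A : ent G (inst t A) -> ent G (Ex A).
Proof. apply ent_seq, ex_intro_seq. Qed.

Lemma ent_ex_elim G A C :
  ent G (Ex A) -> ent (A :: map (lift 1) G) (lift 1 C) -> ent G C.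
Proof.
  intros H HA. eapply ba_trans.
  - apply ba_and_intro; [apply ba_id|exact H].
  - eapply ba_trans; [apply ba_and_ex|]. apply ba_ex_elim.
    rewrite lift_conj. eapply ba_trans; [apply and_comm|exact HA].
Qed.

Lemma ent_all G n A B : ent (A :: map (lift n) G) B -> ent G (All n A B).
Proof.
  intros H. apply ba_all_intro. rewrite lift_conj.
  eapply ba_trans; [apply and_comm|exact H].
Qed.

Lemma map_lift_0 G : map (lift 0) G = G.
Proof.
  rewrite <- (map_id G) at 2. apply map_ext. intros A. apply subst_Var.
Qed.

Lemma ent_imp G A B : ent (A :: G) B -> ent G (Imp A B).
Proof. intros H. apply ent_all. now rewrite map_lift_0. Qed.

Lemma ent_subst f G A : ent G A -> ent (map (subst f) G) (subst f A).
Proof.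
  intros H. unfold ent. replace (Conj (map (subst f) G)) with (subst f (Conj G)).
  - now apply ba_subst.
  - clear H. induction G; simpl; congruence.
Qed.

Lemma all_inst_seq n ts A B :
  EBA (All n A B) (Imp (inst_block n ts A) (inst_block n ts B)).
Proof.
  eapply ba_trans; [apply (ba_all_subst _ n (fun x => tlift n (ts x)))|].
  (* Only indices from [n] on are left, so the truncated subtraction is exact on them. *)
  set (r := fun x => x - n).
  assert (E : forall C,
    rename r (replace_block n (fun x => tlift n (ts x)) C) = inst_block n ts C).
  { intros C. unfold rename, replace_block, inst_block. rewrite subst_comp.
    f_equal. extensionality x. unfold tcomp. ltb_cases; [|reflexivity].
    unfold tlift. rewrite tsubst_comp. rewrite <- (tsubst_Var (ts x)) at 2.
    f_equal. extensionality y. unfold tcomp, r. simpl. f_equal. lia. }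
  rewrite <- !E. apply ba_all_block. intros k. unfold r. lia.
Qed.

(** * Stable formulas and modus ponens *)

Definition Stable (A : form) : Prop := EBA (Imp Top A) A.

(** The one place where the sequent that EBA adds to BA enters. *)
Lemma Stable_Bot : Stable Bot.
Proof. now apply ba_extra. Qed.

Lemma Stable_subst f A : Stable A -> Stable (subst f A).
Proof.
  intros H. apply (ba_subst _ f) in H. now rewrite subst_Imp in H.
Qed.

(** A derivable [A] gives [Top -> A]; composed with the instance of [A -> B] this is [Top -> B], and
    stability removes the [Top]. *)
Lemma ent_all_elim G n ts A B : Stable B ->
  ent G (All n A B) -> ent G (inst_block n ts A) -> ent G (inst_block n ts B).
Proof.
  intros HB H HA. apply (ent_seq _ (Imp Top (inst_block n ts B))).
  - now apply Stable_subst.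
  - eapply ba_trans; [|apply (ba_all_trans _ 0 Top (inst_block n ts A))].
    apply ba_and_intro.
    + apply ent_imp. apply (ent_weaken G); [|exact HA]. now apply incl_tl.
    + now apply (ent_seq _ (All n A B)); [apply all_inst_seq|].
Qed.

Lemma inst_block_0 ts A : inst_block 0 ts A = A.
Proof. rewrite inst_block_env, env_app_0. apply subst_Var. Qed.

Lemma ent_mp G A B : Stable B -> ent G (Imp A B) -> ent G A -> ent G B.
Proof.
  intros HB H HA. rewrite <- (inst_block_0 Var B).
  apply (ent_all_elim _ _ _ A); rewrite ?inst_block_0; assumption.
Qed.

Lemma ent_neg_elim G A : ent G (Neg A) -> ent G A -> ent G Bot.
Proof. apply ent_mp, Stable_Bot. Qed.

(** * Equality and elementary arithmetic *)

(** Carries sequents stated for variables over to terms. The default [Zero] is never reached in a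
    result: each list covers the free variables of the sequent it is applied to. *)
Definition env_list (ts : list term) : nat -> term := fun x => nth x ts Zero.

Lemma ent_refl G t : ent G (Eq t t).
Proof. apply ent_thm. apply (ba_subst _ (fun _ => t) _ _ (ba_refl _ 0)). Qed.

Lemma ent_euclid G s t u : ent G (Eq s t) -> ent G (Eq s u) -> ent G (Eq t u).
Proof.
  intros H1 H2. eapply ent_seq; [|exact (ent_and _ _ _ H1 H2)].
  exact (ba_subst _ (env_list [s; t; u]) _ _
           (ba_eq _ 0 1 (Eq (Var 0) (Var 2)) (atomic_Eq _ _))).
Qed.

Lemma ent_sym G s t : ent G (Eq s t) -> ent G (Eq t s).
Proof. intros H. apply (ent_euclid _ s); [exact H|apply ent_refl]. Qed.

Lemma ent_eq_trans G s t u :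
  ent G (Eq s t) -> ent G (Eq t u) -> ent G (Eq s u).
Proof. intros H. now apply ent_euclid, ent_sym. Qed.

Lemma ent_Succ G s t : ent G (Eq s t) -> ent G (Eq (Succ s) (Succ t)).
Proof.
  intros H. eapply ent_seq; [|exact (ent_and _ _ _ H (ent_refl _ (Succ s)))].
  (* Variable 2 is a second name for [s], so that only the right-hand occurrence in
     [Succ s = Succ s] is rewritten. *)
  exact (ba_subst _ (env_list [s; t; s]) _ _
           (ba_eq _ 0 1 (Eq (Succ (Var 2)) (Succ (Var 0))) (atomic_Eq _ _))).
Qed.

Lemma ent_Add G s t s' t' : ent G (Eq s t) -> ent G (Eq s' t') ->
  ent G (Eq (Add s s') (Add t t')).
Proof.
  intros H H'. apply (ent_eq_trans _ _ (Add t s')).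
  - eapply ent_seq; [|exact (ent_and _ _ _ H (ent_refl _ (Add s s')))].
    exact (ba_subst _ (env_list [s; t; s; s']) _ _
      (ba_eq _ 0 1 (Eq (Add (Var 2) (Var 3)) (Add (Var 0) (Var 3)))
         (atomic_Eq _ _))).
  - eapply ent_seq; [|exact (ent_and _ _ _ H' (ent_refl _ (Add t s')))].
    exact (ba_subst _ (env_list [s'; t'; s'; t]) _ _
      (ba_eq _ 0 1 (Eq (Add (Var 3) (Var 2)) (Add (Var 3) (Var 0)))
         (atomic_Eq _ _))).
Qed.

Lemma ent_Mul G s t s' t' : ent G (Eq s t) -> ent G (Eq s' t') ->
  ent G (Eq (Mul s s') (Mul t t')).
Proof.
  intros H H'. apply (ent_eq_trans _ _ (Mul t s')).
  - eapply ent_seq; [|exact (ent_and _ _ _ H (ent_refl _ (Mul s s')))].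
    exact (ba_subst _ (env_list [s; t; s; s']) _ _
      (ba_eq _ 0 1 (Eq (Mul (Var 2) (Var 3)) (Mul (Var 0) (Var 3)))
         (atomic_Eq _ _))).
  - eapply ent_seq; [|exact (ent_and _ _ _ H' (ent_refl _ (Mul t s')))].
    exact (ba_subst _ (env_list [s'; t'; s'; t]) _ _
      (ba_eq _ 0 1 (Eq (Mul (Var 3) (Var 2)) (Mul (Var 3) (Var 0)))
         (atomic_Eq _ _))).
Qed.

Lemma ent_tsubst_eq G f g t :
  (forall x, ent G (Eq (f x) (g x))) -> ent G (Eq (tsubst f t) (tsubst g t)).
Proof.
  intros H. induction t; simpl;
    [apply H|apply ent_refl|apply ent_Succ|apply ent_Add|apply ent_Mul];
    assumption.
Qed.

(** Composition of [All] on both sides does this without any modus ponens. *)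
Lemma ent_all_mono G n A B A' B' :
  ent (A' :: map (lift n) G) A -> ent (B :: map (lift n) G) B' ->
  ent G (All n A B) -> ent G (All n A' B').
Proof.
  intros HA HB H. eapply ba_trans; [|apply (ba_all_trans _ n _ B)].
  apply ba_and_intro; [|now apply ent_all].
  eapply ba_trans; [|apply (ba_all_trans _ n _ A)].
  apply ba_and_intro; [now apply ent_all|exact H].
Qed.

Lemma ent_map_lift n G A : ent G A -> ent (map (lift n) G) (lift n A).
Proof. apply ent_subst. Qed.

Lemma ent_up_eq n G f g :
  (forall x, ent G (Eq (f x) (g x))) ->
  forall x, ent (map (lift n) G) (Eq (up n f x) (up n g x)).
Proof.
  intros H x. unfold up. ltb_cases; [apply ent_refl|].
  exact (ent_map_lift n _ _ (H (x - n))).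
Qed.

Lemma ent_tl G A B : ent G A -> ent (B :: G) A.
Proof. apply ent_weaken. now apply incl_tl. Qed.

Lemma ent_hd G A : ent (A :: G) A.
Proof. apply ent_hyp. now left. Qed.

(** Extends the replacement axiom from atomic to all formulas. Provably equal substitutions, unlike
    a single replaced variable, pass under binders; left of [All] the roles of [f] and [g] are
    exchanged. *)
Lemma ent_subst_eq A : forall G f g,
  (forall x, ent G (Eq (f x) (g x))) -> ent G (subst f A) -> ent G (subst g A).
Proof.
  induction A as [| |s t|A IHA B IHB|A IHA B IHB|A IHA|n A IHA B IHB];
    simpl; intros G f g E H.
  - exact H.
  - exact H.
  - apply (ent_eq_trans _ _ (tsubst f t)); [|now apply ent_tsubst_eq].
    eapply ent_eq_trans; [|exact H]. now apply ent_sym, ent_tsubst_eq.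
  - apply ent_and; [apply (IHA _ f)|apply (IHB _ f)]; trivial;
      [eapply ent_and1|eapply ent_and2]; exact H.
  - apply (ent_or_elim _ _ _ _ H); [apply ent_or1, (IHA _ f)|apply ent_or2, (IHB _ f)];
      auto using ent_tl, ent_hd.
  - apply (ent_ex_elim _ _ _ H). rewrite lift_shift. simpl subst.
    apply (ent_ex _ (Var 0)).
    rewrite inst_Var0. apply (IHA _ (up 1 f)); [|apply ent_hd].
    intros x. now apply ent_tl, ent_up_eq.
  - revert H. apply ent_all_mono.
    + apply (IHA _ (up n g)); [|apply ent_hd].
      intros x. apply ent_tl, ent_sym. now apply ent_up_eq.
    + apply (IHB _ (up n f)); [|apply ent_hd].
      intros x. apply ent_tl. now apply ent_up_eq.
Qed.

Lemma ent_inst_eq G s t A :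
  ent G (Eq s t) -> ent G (inst s A) -> ent G (inst t A).
Proof.
  intros H. apply ent_subst_eq. intros x. ltb_cases; [exact H|apply ent_refl].
Qed.

Lemma ent_add_0 G s : ent G (Eq (Add s Zero) s).
Proof.
  apply ent_thm. exact (ba_subst _ (env_list [s]) _ _ (ba_add_zero _ 0)).
Qed.

Lemma ent_add_S G s t : ent G (Eq (Add s (Succ t)) (Succ (Add s t))).
Proof.
  apply ent_thm. exact (ba_subst _ (env_list [s; t]) _ _ (ba_add_succ _ 0 1)).
Qed.

Lemma ent_S_0 G s : ent G (Eq (Succ s) Zero) -> ent G Bot.
Proof.
  apply ent_seq. exact (ba_subst _ (env_list [s]) _ _ (ba_succ_zero _ 0)).
Qed.

Lemma ent_S_inj G s t : ent G (Eq (Succ s) (Succ t)) -> ent G (Eq s t).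
Proof.
  apply ent_seq. exact (ba_subst _ (env_list [s; t]) _ _ (ba_succ_inj _ 0 1)).
Qed.

Lemma ind_thm A : EBA Top (replace 0 Zero A) ->
  EBA A (replace 0 (Succ (Var 0)) A) -> EBA Top A.
Proof.
  intros H0 HS. eapply ba_trans; [exact H0|]. now apply ba_ind_rule.
Qed.

Lemma ent_0_add G s : ent G (Eq (Add Zero s) s).
Proof.
  apply ent_thm.
  refine (ba_subst _ (env_list [s]) Top (Eq (Add Zero (Var 0)) (Var 0)) _).
  apply ind_thm; cbn.
  - apply seq_ent, ent_add_0.
  - apply seq_ent. eapply ent_eq_trans; [apply ent_add_S|].
    apply ent_Succ, ent_hd.
Qed.

Lemma ent_S_add G s t : ent G (Eq (Add (Succ s) t) (Succ (Add s t))).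
Proof.
  apply ent_thm.
  refine (ba_subst _ (env_list [t; s]) Top
    (Eq (Add (Succ (Var 1)) (Var 0)) (Succ (Add (Var 1) (Var 0)))) _).
  apply ind_thm; cbn; apply seq_ent.
  - eapply ent_eq_trans; [apply ent_add_0|].
    apply ent_Succ, ent_sym, ent_add_0.
  - eapply ent_eq_trans; [apply ent_add_S|]. apply ent_Succ.
    eapply ent_eq_trans; [apply ent_hd|]. apply ent_sym, ent_add_S.
Qed.

Lemma zero_or_succ :
  EBA Top (Or (Eq (Var 0) Zero) (Ex (Eq (Var 1) (Succ (Var 0))))).
Proof.
  apply ind_thm; cbn; apply seq_ent.
  - apply ent_or1, ent_refl.
  - apply ent_or2, (ent_ex _ (Var 0)). apply ent_refl.
Qed.

Lemma ent_zero_or_succ G t C : ent (Eq t Zero :: G) C ->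
  ent (Eq (tlift 1 t) (Succ (Var 0)) :: map (lift 1) G) (lift 1 C) -> ent G C.
Proof.
  intros H0 HS. apply (ent_or_elim _ (Eq t Zero) (Ex (Eq (tlift 1 t) (Succ (Var 0))))).
  - apply ent_thm. exact (ba_subst _ (env_list [t]) _ _ zero_or_succ).
  - exact H0.
  - eapply ent_ex_elim; [apply ent_hd|].
    eapply ent_weaken; [|exact HS]. simpl. intros A [->|HA]; simpl; auto.
Qed.

(** By induction on [s]: [ent_S_add] brings the successor outside, where it cancels. The claim is
    turned into a negation to fit [ind_thm]. *)
Lemma ent_add_S_irrefl G s t : ent G (Eq (Add s (Succ t)) s) -> ent G Bot.
Proof.
  intros H. eapply ent_neg_elim; [|exact H]. apply ent_thm.
  enough (K : EBA Top (Neg (Eq (Add (Var 0) (Succ (Var 1))) (Var 0)))).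
  { apply (ba_subst _ (env_list [s; t])) in K. now rewrite subst_Neg in K. }
  apply ind_thm; cbn; apply seq_ent, ent_imp.
  - eapply ent_S_0. eapply ent_eq_trans; [|apply ent_hd].
    apply ent_sym, ent_add_S.
  - eapply ent_neg_elim; [apply ent_tl, ent_hd|]. apply ent_S_inj.
    eapply ent_eq_trans; [|apply ent_hd]. apply ent_sym, ent_S_add.
Qed.

(** * The order *)

Lemma ent_lt G s t u : ent G (Eq (Add s (Succ u)) t) -> ent G (Lt s t).
Proof.
  intros H. apply (ent_ex _ u). unfold inst, inst_block. simpl.
  change (ent G (Eq (Add (tsubst (env_app 1 (fun _ => u) Var) (tlift 1 s)) (Succ u))
    (tsubst (env_app 1 (fun _ => u) Var) (tlift 1 t)))).
  rewrite !tlift_shift, !tsubst_comp, env_app_shift, !tsubst_Var. exact H.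
Qed.

Lemma ent_lt_0 G s : ent G (Lt s Zero) -> ent G Bot.
Proof.
  intros H. apply (ent_ex_elim _ _ _ H). cbn. eapply ent_S_0.
  eapply ent_eq_trans; [|apply ent_hd]. apply ent_sym, ent_add_S.
Qed.

Lemma ent_lt_S_eq G s t : ent G (Eq s t) -> ent G (Lt s (Succ t)).
Proof.
  intros H. apply (ent_lt _ _ _ Zero). eapply ent_eq_trans; [apply ent_add_S|].
  apply ent_Succ. eapply ent_eq_trans; [apply ent_add_0|exact H].
Qed.

Lemma lift_Lt n s t : lift n (Lt s t) = Lt (tlift n s) (tlift n t).
Proof. apply subst_Lt. Qed.

Lemma ent_lt_S_lt G s t : ent G (Lt s t) -> ent G (Lt s (Succ t)).
Proof.
  intros H. apply (ent_ex_elim _ _ _ H). rewrite lift_Lt.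
  apply (ent_lt _ _ _ (Succ (Var 0))). eapply ent_eq_trans; [apply ent_add_S|].
  apply ent_Succ, ent_hd.
Qed.

Lemma ent_lt_S_elim G s t :
  ent G (Lt s (Succ t)) -> ent G (Or (Lt s t) (Eq s t)).
Proof.
  intros H. apply (ent_ex_elim _ _ _ H).
  change (lift 1 (Or (Lt s t) (Eq s t)))
    with (Or (lift 1 (Lt s t)) (Eq (tlift 1 s) (tlift 1 t))).
  rewrite lift_Lt. change (tlift 1 (Succ t)) with (Succ (tlift 1 t)).
  set (s' := tlift 1 s). set (t' := tlift 1 t).
  eapply ent_cut.
  { apply ent_S_inj. eapply ent_eq_trans; [|apply ent_hd].
    apply ent_sym, ent_add_S. }
  apply (ent_zero_or_succ _ (Var 0)).
  - apply ent_or2. eapply ent_eq_trans; [|apply ent_tl, ent_hd].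
    apply ent_sym. eapply ent_eq_trans; [|apply ent_add_0].
    apply ent_Add; [apply ent_refl|apply ent_hd].
  - change (lift 1 (Or (Lt s' t') (Eq s' t')))
      with (Or (lift 1 (Lt s' t')) (lift 1 (Eq s' t'))).
    apply ent_or1. rewrite lift_Lt. apply (ent_lt _ _ _ (Var 0)).
    eapply ent_eq_trans.
    + apply ent_Add; [apply ent_refl|apply ent_sym, ent_hd].
    + apply ent_hyp. simpl. right. left. reflexivity.
Qed.

Lemma ent_lt_irrefl G s t : ent G (Lt s t) -> ent G (Eq s t) -> ent G Bot.
Proof.
  intros H E. apply (ent_ex_elim _ _ _ H). cbn.
  apply (ent_add_S_irrefl _ (tlift 1 s) (Var 0)).
  eapply ent_eq_trans; [apply ent_hd|]. apply ent_tl, ent_sym.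
  exact (ent_map_lift 1 _ _ E).
Qed.

Lemma trichotomy :
  EBA Top (Or (Eq (Var 0) (Var 1)) (Or (Lt (Var 0) (Var 1)) (Lt (Var 1) (Var 0)))).
Proof.
  apply ind_thm.
  - change (EBA Top (Or (Eq Zero (Var 1)) (Or (Lt Zero (Var 1)) (Lt (Var 1) Zero)))).
    apply seq_ent, (ent_zero_or_succ _ (Var 1)).
    + apply ent_or1, ent_sym, ent_hd.
    + apply ent_or2, ent_or1.
      apply (ent_lt _ Zero (Var 2) (Var 0)). eapply ent_eq_trans; [apply ent_0_add|].
      apply ent_sym, ent_hd.
  - change (EBA (Or (Eq (Var 0) (Var 1)) (Or (Lt (Var 0) (Var 1)) (Lt (Var 1) (Var 0))))
      (Or (Eq (Succ (Var 0)) (Var 1))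
          (Or (Lt (Succ (Var 0)) (Var 1)) (Lt (Var 1) (Succ (Var 0)))))).
    repeat apply ba_or_elim; apply seq_ent.
    + apply ent_or2, ent_or2, ent_lt_S_eq, ent_sym, ent_hd.
    + eapply ent_ex_elim; [apply ent_hd|].
      (* Given [x + Sz = y]: if [z] is 0 then [Sx = y], and if [z] is [Sw] then [w] witnesses
         [Sx < y]. *)
      apply (ent_zero_or_succ _ (Var 0)).
      * apply ent_or1. cbn.
        eapply ent_eq_trans; [|apply ent_tl, ent_hd].
        eapply ent_eq_trans; [|apply ent_sym, ent_add_S].
        apply ent_Succ, ent_sym. eapply ent_eq_trans; [|apply ent_add_0].
        apply ent_Add; [apply ent_refl|apply ent_hd].
      * apply ent_or2, ent_or1, (ent_lt _ (Succ (Var 2)) (Var 3) (Var 0)).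
        eapply ent_eq_trans; [apply ent_S_add|].
        eapply ent_eq_trans; [apply ent_sym, ent_add_S|].
        eapply ent_eq_trans; [|apply ent_tl, ent_hd].
        apply ent_Add; [apply ent_refl|apply ent_Succ, ent_sym, ent_hd].
    + apply ent_or2, ent_or2, ent_lt_S_lt, ent_hd.
Qed.

(** * Decidability of [Delta0] formulas *)

Definition Dec (A : form) : Prop := EBA Top (Or A (Neg A)).

Lemma ent_dec G A C : Dec A -> ent (A :: G) C -> ent (Neg A :: G) C -> ent G C.
Proof. intros H. apply ent_or_elim. now apply ent_thm. Qed.

Lemma Dec_subst f A : Dec A -> Dec (subst f A).
Proof.
  intros H. apply (ba_subst _ f) in H. simpl subst in H.
  change (EBA Top (Or (subst f A) (subst f (Neg A)))) in H.
  now rewrite subst_Neg in H.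
Qed.

(** [Top -> A] composed with [A -> Bot] is [Top -> Bot], which the stability of [Bot] turns into
    [Bot]. *)
Lemma Stable_of_dneg A : EBA (Neg (Neg A)) A -> Stable A.
Proof.
  intros H. apply seq_ent. apply (ent_seq _ _ _ H). apply ent_imp.
  apply (ent_seq _ (Imp Top Bot)); [apply Stable_Bot|].
  eapply ba_trans; [|apply (ba_all_trans _ 0 Top A)].
  apply ent_and; [apply ent_tl|]; apply ent_hd.
Qed.

Lemma Dec_dneg A : Dec A -> EBA (Neg (Neg A)) A.
Proof.
  intros H. apply seq_ent. apply (ent_dec _ _ _ H); [apply ent_hd|].
  apply ent_bot. eapply ent_neg_elim; [apply ent_tl|]; apply ent_hd.
Qed.

Lemma Dec_Stable A : Dec A -> Stable A.
Proof. intros H. now apply Stable_of_dneg, Dec_dneg. Qed.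

Lemma ent_ex_lift G A : ent G A -> ent G (lift 1 (Ex A)).
Proof.
  intros H. rewrite lift_shift. simpl. apply (ent_ex _ (Var 0)).
  now rewrite inst_Var0.
Qed.

Lemma inst_block_Var n A : inst_block n Var (subst (up n (shift n)) A) = A.
Proof.
  rewrite inst_block_env, subst_comp, env_app_up.
  rewrite <- (subst_Var A) at 2. f_equal. extensionality x.
  unfold env_app, tcomp, shift. ltb_cases; simpl; f_equal. lia.
Qed.

(** The free variables with the indices of the block are put for the block, which undoes the
    lift. *)
Lemma ent_all_lift G n A B :
  Stable B -> ent G (lift n (All n A B)) -> ent G A -> ent G B.
Proof.
  intros HB H HA. rewrite <- (inst_block_Var n B).
  apply (ent_all_elim _ _ _ (subst (up n (shift n)) A)).
  - now apply Stable_subst.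
  - exact H.
  - now rewrite inst_block_Var.
Qed.

Lemma Dec_Eq s t : Dec (Eq s t).
Proof.
  apply (Dec_subst (env_list [s; t]) (Eq (Var 0) (Var 1))).
  apply (ba_trans _ _ _ _ trichotomy).
  repeat apply ba_or_elim; apply seq_ent.
  - apply ent_or1, ent_hd.
  - apply ent_or2, ent_imp.
    eapply ent_lt_irrefl; [apply ent_tl|]; apply ent_hd.
  - apply ent_or2, ent_imp.
    eapply ent_lt_irrefl; [apply ent_tl|apply ent_sym]; apply ent_hd.
Qed.

(** By induction on the right-hand side, which is therefore made variable 0: [s < St] splits into
    [s < t] and [s = t], and equations are already decided. *)
Lemma Dec_Lt s t : Dec (Lt s t).
Proof.
  enough (H : Dec (Lt (Var 1) (Var 0))).
  { apply (Dec_subst (env_list [t; s])) in H. now rewrite subst_Lt in H. }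
  apply ind_thm.
  - change (EBA Top (Or (Lt (Var 1) Zero) (Neg (Lt (Var 1) Zero)))).
    apply seq_ent, ent_or2, ent_imp, (ent_lt_0 _ (Var 1)), ent_hd.
  - change (EBA (Or (Lt (Var 1) (Var 0)) (Neg (Lt (Var 1) (Var 0))))
      (Or (Lt (Var 1) (Succ (Var 0))) (Neg (Lt (Var 1) (Succ (Var 0)))))).
    apply ba_or_elim; apply seq_ent.
    + apply ent_or1, ent_lt_S_lt, ent_hd.
    + apply (ent_dec _ _ _ (Dec_Eq (Var 1) (Var 0))).
      * apply ent_or1, ent_lt_S_eq, ent_hd.
      * apply ent_or2, ent_imp.
        eapply ent_or_elim; [apply ent_lt_S_elim, ent_hd| |].
        -- apply (ent_neg_elim _ (Lt (Var 1) (Var 0))); [|apply ent_hd].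
           apply ent_hyp; simpl; tauto.
        -- apply (ent_neg_elim _ (Eq (Var 1) (Var 0))); [|apply ent_hd].
           apply ent_hyp; simpl; tauto.
Qed.

(** By the induction rule on the bound [s]. *)
Lemma bounded_dichotomy A B s : Stable B -> EBA Top (Or A B) ->
  EBA Top (Or (Ex (And (Lt (Var 0) (tlift 1 s)) A))
              (All 1 (Lt (Var 0) (tlift 1 s)) B)).
Proof.
  intros SB HAB.
  (* The parameters move up by one to make room for the bound, the induction variable, as index 0
     outside the quantifier. *)
  set (A1 := subst (up 1 (shift 1)) A). set (B1 := subst (up 1 (shift 1)) B).
  set (P := fun t => Or (Ex (And (Lt (Var 0) (tlift 1 t)) A1))
                        (All 1 (Lt (Var 0) (tlift 1 t)) B1)).
  assert (EP : forall r t, tcomp r (shift 1) = shift 1 ->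
    subst r (P t) = P (tsubst r t)).
  { intros r t Hr. unfold P, A1, B1. cbn [subst].
    now rewrite !subst_Lt, tsubst_tlift, !subst_comp, up_comp, Hr. }
  assert (HP : EBA Top (P (Var 0))).
  { apply ind_thm; unfold replace; rewrite EP by reflexivity; simpl tsubst.
    - apply seq_ent, ent_or2, ent_all, ent_bot.
      apply (ent_lt_0 _ (Var 0)), ent_hd.
    - apply ba_or_elim; apply seq_ent.
      + eapply ent_ex_elim; [apply ent_hd|]. apply ent_or1.
        apply (ent_ex_lift _ (And (Lt (Var 0) (Succ (Var 1))) A1)).
        apply ent_and.
        * eapply ent_lt_S_lt, ent_and1, ent_hd.
        * eapply ent_and2, ent_hd.
      (* In this context index 0 of the unshifted [A] and [B] is the old bound, so the hypothesis
         settles the one new instance. *)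
      + apply (ent_or_elim _ A B); [now apply ent_thm| |].
        * apply ent_or1, (ent_ex _ (Var 0)).
          change (ent (A :: [All 1 (Lt (Var 0) (Var 1)) B1])
            (And (Lt (Var 0) (Succ (Var 0))) (inst (Var 0) A1))).
          unfold A1. rewrite inst_Var0.
          apply ent_and; [apply ent_lt_S_eq, ent_refl|apply ent_hd].
        * apply ent_or2, ent_all.
          eapply ent_or_elim;
            [apply (ent_lt_S_elim _ (Var 0) (Var 1)), ent_hd| |].
          -- apply (ent_all_lift _ 1 (Lt (Var 0) (Var 1)));
               [now apply Stable_subst| |apply ent_hd].
             apply ent_hyp; simpl; tauto.
          (* [shift 1] reads [B] at the old bound, to which the quantified variable is equal in this
             case. *)
          -- apply (ent_subst_eq B _ (shift 1)).
             ++ intros [|x]; [apply ent_sym, ent_hd|].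
                unfold up, shift. simpl. rewrite Nat.sub_0_r. apply ent_refl.
             ++ apply ent_hyp; simpl; tauto. }
  apply (ba_subst _ (env_app 1 (fun _ => s) Var)) in HP.
  unfold P, A1, B1 in HP. cbn [subst] in HP.
  rewrite !subst_Lt, tsubst_tlift, !subst_comp, up_comp, env_app_shift, up_Var,
    !subst_Var in HP.
  exact HP.
Qed.

Lemma Dec_And A B : Dec A -> Dec B -> Dec (And A B).
Proof.
  intros HA HB. apply seq_ent. apply (ent_dec _ _ _ HA).
  - apply (ent_dec _ _ _ HB).
    + apply ent_or1, ent_and; [apply ent_tl|]; apply ent_hd.
    + apply ent_or2, ent_imp. eapply ent_neg_elim; [apply ent_tl, ent_hd|].
      eapply ent_and2, ent_hd.
  - apply ent_or2, ent_imp. eapply ent_neg_elim; [apply ent_tl, ent_hd|].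
    eapply ent_and1, ent_hd.
Qed.

Lemma Dec_Or A B : Dec A -> Dec B -> Dec (Or A B).
Proof.
  intros HA HB. apply seq_ent. apply (ent_dec _ _ _ HA).
  - apply ent_or1, ent_or1, ent_hd.
  - apply (ent_dec _ _ _ HB).
    + apply ent_or1, ent_or2, ent_hd.
    + apply ent_or2, ent_imp. eapply ent_or_elim; [apply ent_hd| |].
      * apply (ent_neg_elim _ A); apply ent_hyp; simpl; tauto.
      * apply (ent_neg_elim _ B); apply ent_hyp; simpl; tauto.
Qed.

Lemma Dec_Imp A B : Dec A -> Dec B -> Dec (Imp A B).
Proof.
  intros HA HB. apply seq_ent. apply (ent_dec _ _ _ HB).
  - apply ent_or1, ent_imp, ent_tl, ent_hd.
  - apply (ent_dec _ _ _ HA).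
    + apply ent_or2, ent_imp. apply (ent_neg_elim _ B).
      * apply ent_hyp; simpl; tauto.
      * apply (ent_mp _ A); [now apply Dec_Stable| |];
          apply ent_hyp; simpl; tauto.
    + apply ent_or1, ent_imp, ent_bot.
      apply (ent_neg_elim _ A); apply ent_hyp; simpl; tauto.
Qed.

Lemma dneg_Neg A : EBA (Neg (Neg (Neg A))) (Neg A).
Proof.
  apply seq_ent, ent_imp.
  apply (ent_neg_elim _ (Neg (Neg A))); [apply ent_tl, ent_hd|].
  apply ent_imp. apply (ent_neg_elim _ A); apply ent_hyp; simpl; tauto.
Qed.

Lemma Stable_Neg A : Stable (Neg A).
Proof. apply Stable_of_dneg, dneg_Neg. Qed.

Lemma neg_ex_seq A : EBA (All 1 A Bot) (Neg (Ex A)).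
Proof. apply (ba_all_ex _ 0 Bot A). Qed.

(** The lift gives the form in which [ba_ex_elim] can refute a universal formula from an existential
    counterexample. *)
Lemma ex_neg_all_seq n A B : Stable B ->
  EBA (And A (Neg B)) (lift n (Neg (All n A B))).
Proof.
  intros SB. apply seq_ent. rewrite lift_shift, subst_Neg. apply ent_imp.
  apply (ent_neg_elim _ B).
  - eapply ent_tl, ent_and2, ent_hd.
  - apply (ent_all_lift _ n A); [exact SB|apply ent_hd|].
    eapply ent_tl, ent_and1, ent_hd.
Qed.

(** By the dichotomy for [A] and [Neg A]: if [Neg A] holds below the bound, [neg_ex_seq] refutes the
    existential formula. *)
Lemma Dec_bounded_Ex s A : Dec A -> Dec (Ex (And (Lt (Var 0) (tlift 1 s)) A)).
Proof.
  intros HA. eapply ba_trans.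
  - apply (bounded_dichotomy A (Neg A) s); [apply Stable_Neg|exact HA].
  - apply ba_or_elim; apply seq_ent; [apply ent_or1, ent_hd|].
    apply ent_or2. eapply ent_seq; [apply neg_ex_seq|]. apply ent_all.
    apply (ent_neg_elim _ A); [|eapply ent_and2, ent_hd].
    apply (ent_all_lift _ 1 (Lt (Var 0) (tlift 1 s))).
    + apply Stable_Neg.
    + apply ent_hyp; simpl; tauto.
    + eapply ent_and1, ent_hd.
Qed.

Lemma bounded_All_dichotomy s A : Dec A ->
  EBA Top (Or (Ex (And (Lt (Var 0) (tlift 1 s)) (Neg A)))
              (All 1 (Lt (Var 0) (tlift 1 s)) A)).
Proof.
  intros HA. apply bounded_dichotomy; [now apply Dec_Stable|].
  apply (ba_trans _ _ _ _ HA).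
  apply ba_or_elim; apply seq_ent; [apply ent_or2|apply ent_or1]; apply ent_hd.
Qed.

Lemma Dec_bounded_All s A : Dec A -> Dec (All 1 (Lt (Var 0) (tlift 1 s)) A).
Proof.
  intros HA. apply (ba_trans _ _ _ _ (bounded_All_dichotomy s A HA)).
  apply ba_or_elim; apply seq_ent; [apply ent_or2|apply ent_or1, ent_hd].
  eapply ent_seq; [|apply ent_hd]. apply ba_ex_elim.
  now apply ex_neg_all_seq, Dec_Stable.
Qed.

Lemma Delta0_Dec A : Delta0 A -> Dec A.
Proof.
  induction 1 as [A HA| | | | |];
    auto using Dec_And, Dec_Or, Dec_Imp, Dec_bounded_Ex, Dec_bounded_All.
  destruct HA.
  - apply seq_ent, ent_or1, ent_hd.
  - apply seq_ent, ent_or2, ent_imp, ent_hd.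
  - apply Dec_Eq.
Qed.

(** * The negative translation of classical logic *)

(** The Gödel-Gentzen translation. Equations stay as they are because EBA decides them, and [All]
    commutes with the translation because only its conclusion has to be stable. *)
Fixpoint neg (A : form) : form :=
  match A with
  | And A B => And (neg A) (neg B)
  | Or A B => Neg (And (Neg (neg A)) (Neg (neg B)))
  | Ex A => Neg (All 1 (neg A) Bot)
  | All n A B => All n (neg A) (neg B)
  | A => A
  end.

Lemma neg_subst A : forall f, neg (subst f A) = subst f (neg A).
Proof.
  induction A; intros f; cbn [subst neg]; rewrite ?subst_Neg; cbn [subst];
    rewrite ?subst_Neg; congruence.
Qed.

Lemma map_neg_lift n G : map neg (map (lift n) G) = map (lift n) (map neg G).
Proof.
  rewrite !map_map. apply map_ext. intros A. apply neg_subst.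
Qed.

Lemma ent_raa G A :
  EBA (Neg (Neg A)) A -> ent (Neg A :: G) Bot -> ent G A.
Proof. intros HA H. apply (ent_seq _ _ _ HA). now apply ent_imp. Qed.

Lemma dneg_All n A B :
  EBA (Neg (Neg B)) B -> EBA (Neg (Neg (All n A B))) (All n A B).
Proof.
  intros HB. apply seq_ent, ent_all. cbn [map].
  rewrite lift_shift, !subst_Neg. apply (ent_raa _ _ HB).
  eapply ent_neg_elim; [apply ent_hyp; right; right; left; reflexivity|].
  apply ent_imp. apply (ent_neg_elim _ B); [apply ent_tl, ent_hd|].
  apply (ent_all_lift _ n A).
  - now apply Stable_of_dneg.
  - apply ent_hd.
  - apply ent_tl, ent_tl, ent_hd.
Qed.

Lemma dneg_And A B : EBA (Neg (Neg A)) A -> EBA (Neg (Neg B)) B ->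
  EBA (Neg (Neg (And A B))) (And A B).
Proof.
  intros HA HB. apply seq_ent, ent_and; [apply (ent_raa _ _ HA)|apply (ent_raa _ _ HB)];
    (eapply ent_neg_elim; [apply ent_tl, ent_hd|]; apply ent_imp;
     eapply ent_neg_elim; [apply ent_tl, ent_hd|]).
  - eapply ent_and1, ent_hd.
  - eapply ent_and2, ent_hd.
Qed.

Lemma dneg_neg A : EBA (Neg (Neg (neg A))) (neg A).
Proof.
  induction A; cbn [neg]; auto using dneg_Neg, dneg_All, dneg_And.
  - apply ba_top.
  - apply Dec_dneg, (Delta0_Dec Bot). repeat constructor.
  - apply Dec_dneg, Dec_Eq.
Qed.

Lemma Stable_neg A : Stable (neg A).
Proof. apply Stable_of_dneg, dneg_neg. Qed.

(** Translated formulas are stable and closed under double negation elimination. The first makes the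
    elimination of [All] sound, the second validates reductio and the eliminations of [Or] and
    [Ex]. *)
Lemma neg_sound T G A : (forall B, T B -> EBA Top (neg B)) ->
  proves T G A -> ent (map neg G) (neg A).
Proof.
  intros HT H. induction H; try (now apply ent_thm, HT); clear HT;
    cbn [map neg] in *; rewrite ?map_neg_lift in *.
  - apply ent_hyp. now apply in_map.
  - now apply (ent_raa _ _ (dneg_neg A)).
  - apply ba_top.
  - now apply ent_and.
  - eapply ent_and1; eassumption.
  - eapply ent_and2; eassumption.
  - apply ent_imp. apply (ent_neg_elim _ (neg A)); [|now apply ent_tl].
    eapply ent_and1, ent_hd.
  - apply ent_imp. apply (ent_neg_elim _ (neg B)); [|now apply ent_tl].
    eapply ent_and2, ent_hd.
  - apply (ent_raa _ _ (dneg_neg C)).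
    eapply ent_neg_elim; [apply ent_tl; eassumption|].
    apply ent_and; apply ent_imp; (eapply ent_neg_elim; [apply ent_tl, ent_hd|]);
      [apply (fun I => ent_weaken _ _ _ I IHproves2)
      |apply (fun I => ent_weaken _ _ _ I IHproves3)];
      intros D; simpl; tauto.
  - apply ent_imp. unfold inst, inst_block in *. rewrite neg_subst in IHproves.
    exact (ent_all_elim _ 1 (fun _ => t) (neg A) Bot Stable_Bot
             (ent_hd _ _) (ent_tl _ _ _ IHproves)).
  - apply (ent_raa _ _ (dneg_neg C)).
    eapply ent_neg_elim; [apply ent_tl; eassumption|].
    apply ent_all. cbn [map]. rewrite lift_shift, subst_Neg.
    eapply ent_neg_elim; [apply ent_tl, ent_hd|].
    rewrite <- neg_subst.
    apply (fun I => ent_weaken _ _ _ I IHproves2). intros D; simpl; tauto.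
  - now apply ent_all.
  - unfold inst_block in *. rewrite neg_subst in *.
    eapply ent_all_elim; [apply Stable_neg|eassumption..].
  - apply ent_refl.
  - unfold inst, inst_block in *. rewrite neg_subst in *.
    eapply ent_inst_eq; eassumption.
Qed.

Lemma replace_Zero A : replace 0 Zero A = lift 1 (inst Zero A).
Proof.
  unfold replace. rewrite inst_env, lift_shift, subst_comp. f_equal.
  extensionality x. unfold tcomp, env_app, shift.
  destruct x; simpl; [reflexivity|]. now rewrite Nat.sub_0_r.
Qed.

Lemma EBA_Q A : Q A -> EBA Top A.
Proof.
  destruct 1.
  - apply seq_ent, ent_imp, (ent_S_0 _ (Var x)), ent_hd.
  - apply seq_ent, ent_imp, ent_S_inj, ent_hd.
  - apply ba_add_zero.
  - apply ba_add_succ.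
  - apply ba_mul_zero.
  - apply ba_mul_succ.
  - exact (ba_subst _ (env_list [Var x]) _ _ zero_or_succ).
Qed.

Lemma neg_Q A : Q A -> EBA Top (neg A).
Proof.
  intros H. destruct H; try (apply EBA_Q; constructor).
  apply seq_ent, ent_imp. apply (ent_zero_or_succ _ (Var x)).
  + eapply ent_neg_elim; [eapply ent_and1, ent_tl, ent_hd|apply ent_hd].
  + set (E := Eq (Var (S x)) (Succ (Var 0))).
    apply (ent_neg_elim _ (lift 1 (Neg (All 1 E Bot)))).
    * rewrite lift_shift, <- subst_Neg. eapply ent_and2, ent_tl, ent_hd.
    * rewrite lift_shift, subst_Neg. apply ent_imp.
      apply (ent_all_lift _ 1 E); [apply Stable_Bot|apply ent_hd|].
      apply ent_tl, ent_hd.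
Qed.

Lemma neg_PA A : PA A -> EBA Top (neg A).
Proof.
  destruct 1 as [A HA|A]; [now apply neg_Q|].
  unfold induction, inst, inst_block, replace. cbn [neg Imp].
  rewrite !neg_subst. apply seq_ent, ent_imp.
  (* BA yields [A[x/0] -> A] under the quantifier; there [A[x/0]] is the lifted base case, which is
     among the hypotheses. *)
  apply (ent_all_mono _ _ (replace 0 Zero (neg A)) (neg A)).
  - rewrite replace_Zero. apply ent_tl. cbn [map].
    eapply ent_and1, ent_hd.
  - apply ent_hd.
  - eapply ent_seq; [apply ba_ind_axiom|]. eapply ent_and2, ent_hd.
Qed.

(** * Bounded formulas agree with their translations *)

Definition Eqv (A : form) : Prop := EBA A (neg A) /\ EBA (neg A) A.

Lemma Eqv_And A B : Eqv A -> Eqv B -> Eqv (And A B).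
Proof.
  intros [HA HA'] [HB HB'].
  split; apply ba_and_intro;
    first [now apply (ba_trans _ _ _ _ (and_fst _ _))
          |now apply (ba_trans _ _ _ _ (and_snd _ _))].
Qed.

(** Decidability serves the way back: [A] and [B] are decided, and the translation excludes that
    both are refuted. *)
Lemma Eqv_Or A B : Dec A -> Dec B -> Eqv A -> Eqv B -> Eqv (Or A B).
Proof.
  intros DA DB [HA HA'] [HB HB']. split; cbn [neg].
  - apply ba_or_elim; apply seq_ent, ent_imp.
    + eapply ent_neg_elim; [eapply ent_and1, ent_hd|].
      apply (ent_seq _ _ _ HA), ent_tl, ent_hd.
    + eapply ent_neg_elim; [eapply ent_and2, ent_hd|].
      apply (ent_seq _ _ _ HB), ent_tl, ent_hd.
  - apply seq_ent. apply (ent_dec _ _ _ DA); [apply ent_or1, ent_hd|].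
    apply (ent_dec _ _ _ DB); [apply ent_or2, ent_hd|].
    apply ent_bot. eapply ent_neg_elim; [apply ent_tl, ent_tl, ent_hd|].
    apply ent_and; apply ent_imp.
    + apply (ent_neg_elim _ A); [apply ent_hyp; simpl; tauto|].
      apply (ent_seq _ _ _ HA'), ent_hd.
    + apply (ent_neg_elim _ B); [apply ent_hyp; simpl; tauto|].
      apply (ent_seq _ _ _ HB'), ent_hd.
Qed.

Lemma Eqv_Ex A : Dec (Ex A) -> Eqv A -> Eqv (Ex A).
Proof.
  intros DA [HA HA']. split; cbn [neg].
  - apply ba_ex_elim, seq_ent. rewrite lift_shift, subst_Neg.
    apply ent_imp. apply (ent_all_lift _ 1 (neg A)).
    + apply Stable_Bot.
    + apply ent_hd.
    + apply (ent_seq _ _ _ HA), ent_tl, ent_hd.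
  - apply seq_ent. apply (ent_dec _ _ _ DA); [apply ent_hd|].
    apply ent_bot. eapply ent_neg_elim; [apply ent_tl, ent_hd|].
    apply ent_all. cbn [map]. rewrite (lift_shift 1 (Neg (Ex A))), subst_Neg.
    eapply ent_neg_elim; [apply ent_tl, ent_hd|].
    apply (ent_ex_lift _ A). apply (ent_seq _ _ _ HA'), ent_hd.
Qed.

Lemma Eqv_All n A B : Eqv A -> Eqv B -> Eqv (All n A B).
Proof.
  intros [HA HA'] [HB HB']. split; cbn [neg]; apply seq_ent.
  - apply (ent_all_mono _ _ A B); try apply ent_hd;
      (eapply ent_seq; [|apply ent_hd]; assumption).
  - apply (ent_all_mono _ _ (neg A) (neg B)); try apply ent_hd;
      (eapply ent_seq; [|apply ent_hd]; assumption).
Qed.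

(** [Lt] hides an unbounded [Ex], so induction on [Delta0] does not reach it and it is treated on
    its own. *)
Lemma Eqv_Lt s t : Eqv (Lt s t).
Proof. apply Eqv_Ex; [apply Dec_Lt|]. split; apply ba_id. Qed.

Lemma Delta0_Eqv A : Delta0 A -> Eqv A.
Proof.
  induction 1 as [A HA| | | |s A|].
  - destruct HA; split; apply ba_id.
  - now apply Eqv_And.
  - apply Eqv_Or; auto using Delta0_Dec.
  - now apply Eqv_All.
  - apply Eqv_Ex.
    + apply Dec_bounded_Ex. now apply Delta0_Dec.
    + apply Eqv_And; [apply Eqv_Lt|assumption].
  - apply Eqv_All; [apply Eqv_Lt|assumption].
Qed.

Lemma PA_conservative A B : Delta0 A -> Delta0 B ->
  proves PA [] (Imp A B) -> EBA A B.
Proof.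
  intros HA HB H. apply (neg_sound _ _ _ neg_PA) in H. cbn [neg map Imp] in H.
  destruct (Delta0_Eqv _ HA) as [EA _], (Delta0_Eqv _ HB) as [_ EB].
  eapply ba_trans; [exact EA|]. eapply ba_trans; [|exact EB].
  apply seq_ent. apply (ent_mp _ (neg A)); [apply Stable_neg| |apply ent_hd].
  now apply ent_tl.
Qed.

(** * Forcing *)

(** A condition [(C, D)] stands for "[C] and not [D]"; it is contradictory when
    EBA proves [C => D].  Free variables act as generic constants, and an
    extension may substitute for them; new ones are supplied by [shift]. *)
Definition cond : Type := form * form.

Definition bad (p : cond) : Prop := EBA (fst p) (snd p).

Definition extends (g : nat -> term) (q p : cond) : Prop :=
  EBA (fst q) (subst g (fst p)) /\ EBA (subst g (snd p)) (snd q).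

Definition der (p : cond) (A : form) : Prop := EBA (fst p) (Or A (snd p)).

(** Forcing of a negation, as an operation on predicates so that it can be iterated. Contradictory
    conditions are allowed as extensions, hence [bad] in place of falsity. *)
Definition not_forced (P : cond -> (nat -> term) -> Prop) (p : cond)
  (f : nat -> term) : Prop :=
  forall q g, extends g q p -> P q (tcomp g f) -> bad q.

(** Here [f] assigns terms to the free variables. [Or] and [Ex] are read through negations, which
    makes the forcing weak, that is, classical. *)
Fixpoint force (A : form) (p : cond) (f : nat -> term) : Prop :=
  match A with
  | Top => True
  | Bot => bad p
  | Eq s t => der p (Eq (tsubst f s) (tsubst f t))
  | And A B => force A p f /\ force B p f
  | Or A B =>
      not_forced (fun q e => not_forced (force A) q e /\ not_forced (force B) q e) p f
  | Ex A =>
      not_forced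
        (not_forced (fun q e => exists t, force A q (env_app 1 (fun _ => t) e))) p f
  | All n A B =>
      forall q g ts, extends g q p ->
        force A q (env_app n ts (tcomp g f)) -> force B q (env_app n ts (tcomp g f))
  end.

Lemma extends_refl p : extends Var p p.
Proof. split; rewrite subst_Var; apply ba_id. Qed.

Lemma extends_trans g h r q p :
  extends h r q -> extends g q p -> extends (tcomp h g) r p.
Proof.
  intros [H1 H2] [H3 H4]. split; rewrite <- subst_comp.
  - apply (ba_trans _ _ _ _ H1). now apply ba_subst.
  - eapply ba_trans; [|exact H2]. now apply ba_subst.
Qed.

Lemma extends_bad g q p : extends g q p -> bad p -> bad q.
Proof.
  intros [H1 H2] H. apply (ba_trans _ _ _ _ H1).
  eapply ba_trans; [|exact H2]. now apply ba_subst.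
Qed.

Lemma der_seq p A B : EBA (And (fst p) A) (Or B (snd p)) -> der p A -> der p B.
Proof.
  intros HA H. apply seq_ent. eapply ent_or_elim.
  - eapply ent_seq; [exact H|apply ent_hd].
  - eapply ent_seq; [exact HA|]. apply ent_and; [apply ent_tl|]; apply ent_hd.
  - apply ent_or2, ent_hd.
Qed.

Lemma der_mono g q p A : extends g q p -> der p A -> der q (subst g A).
Proof.
  intros [H1 H2] H. apply (ba_trans _ _ _ _ H1).
  apply (ba_trans _ _ (subst g (Or A (snd p)))); [now apply ba_subst|].
  apply ba_or_elim; apply seq_ent; [apply ent_or1, ent_hd|].
  apply ent_or2, (ent_seq _ _ _ H2), ent_hd.
Qed.

Lemma not_forced_mono P g q p f :
  extends g q p -> not_forced P p f -> not_forced P q (tcomp g f).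
Proof.
  intros Hg H r h Hh HP. apply (H r (tcomp h g)).
  - eapply extends_trans; eassumption.
  - now rewrite tcomp_assoc in HP.
Qed.

Lemma force_mono A : forall g q p f,
  extends g q p -> force A p f -> force A q (tcomp g f).
Proof.
  induction A as [| |s t|A IHA B IHB|A IHA B IHB|A IHA|n A IHA B IHB];
    cbn [force]; intros g q p f Hg H.
  - exact H.
  - now apply (extends_bad g q p).
  - rewrite <- !tsubst_comp. exact (der_mono _ _ _ _ Hg H).
  - split; [apply (IHA g q p)|apply (IHB g q p)]; tauto.
  - now apply (not_forced_mono _ g q p).
  - now apply (not_forced_mono _ g q p).
  - intros r h ts Hh. rewrite tcomp_assoc. apply H.
    eapply extends_trans; eassumption.
Qed.

Definition monotone (P : cond -> (nat -> term) -> Prop) : Prop :=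
  forall g q p f, extends g q p -> P p f -> P q (tcomp g f).

Lemma not_forced_elim (P : cond -> (nat -> term) -> Prop) p f :
  not_forced P p f -> P p f -> bad p.
Proof.
  intros H HP. apply (H p Var); [apply extends_refl|]. now rewrite tcomp_Var_l.
Qed.

(** Triple negation reduces to single negation, as in intuitionistic logic. *)
Lemma not_forced_stable P p f : monotone P ->
  not_forced (not_forced (not_forced P)) p f -> not_forced P p f.
Proof.
  intros HP H q g Hg Hq. apply (H q g Hg). intros r h Hh Hr.
  apply (not_forced_elim P r (tcomp h (tcomp g f))); [exact Hr|].
  now apply (HP h r q).
Qed.

(** Forcing is closed under double negation, which is what validates classical reductio. *)
Lemma force_stable A : forall p f,
  not_forced (not_forced (force A)) p f -> force A p f.
Proof.
  induction A as [| |s t|A IHA B IHB|A IHA B IHB|A IHA|n A IHA B IHB];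
    cbn [force]; intros p f H.
  - exact I.
  - apply (not_forced_elim _ _ _ H). intros q g _ Hq. exact Hq.
  - set (E := Eq (tsubst f s) (tsubst f t)).
    (* With [p = (C, D)], pass to [(C, E \/ D)]. It refutes [E], as any extension forcing [E] is
       contradictory; so it is itself contradictory, which says that [C => E \/ D]. *)
    refine (H (fst p, Or E (snd p)) Var _ _).
    { split; rewrite subst_Var; [apply ba_id|].
      apply seq_ent, ent_or2, ent_hd. }
    rewrite tcomp_Var_l. intros r h [_ Hr] HE.
    apply (ba_trans _ _ _ _ HE), ba_or_elim; [|apply ba_id].
    rewrite <- !tsubst_comp. eapply ba_or_intro1. exact Hr.
  - split; [apply IHA|apply IHB]; intros q g Hg Hq; apply (H q g Hg);
      intros r h Hh [HA HB]; now apply (Hq r h).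
  - apply not_forced_stable; [|exact H]. intros g q r e Hg [HA HB].
    split; now apply (not_forced_mono _ g q r).
  - apply not_forced_stable; [|exact H]. intros g q r e Hg.
    now apply not_forced_mono.
  (* A condition that forces [A] and refutes [B] at [ts] refutes [All n A B], so by hypothesis it is
     contradictory. *)
  - intros q g ts Hg HA. apply IHB. intros r h Hh HB.
    apply (H r (tcomp h g)); [eapply extends_trans; eassumption|].
    intros u k Hk HAB. apply (HB u k Hk).
    specialize (HAB u Var (tcomp k (tcomp h ts)) (extends_refl u)).
    rewrite tcomp_Var_l in HAB. rewrite !tcomp_env_app, !tcomp_assoc in *.
    apply HAB. rewrite <- !tcomp_assoc in *.
    rewrite <- !tcomp_env_app. apply (force_mono _ k u r); [exact Hk|].
    rewrite tcomp_env_app. apply (force_mono _ h r q) in HA; [|exact Hh].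
    now rewrite tcomp_env_app in HA.
Qed.

Lemma force_Neg A p f : force (Neg A) p f <-> not_forced (force A) p f.
Proof.
  split; intros H.
  - intros q g Hg HA. apply (H q g Var Hg). now rewrite env_app_0.
  - intros q g ts Hg. rewrite env_app_0. now apply H.
Qed.

Lemma not_forced_imp (P R : cond -> (nat -> term) -> Prop) p f f' :
  (forall q g, extends g q p -> P q (tcomp g f') -> R q (tcomp g f)) ->
  not_forced R p f -> not_forced P p f'.
Proof. intros HPR H q g Hg HP. apply (H q g Hg). now apply HPR. Qed.

Lemma force_subst A : forall h p f,
  force (subst h A) p f <-> force A p (tcomp f h).
Proof.
  induction A as [| |s t|A IHA B IHB|A IHA B IHB|A IHA|n A IHA B IHB];
    cbn [force subst]; intros h p f.
  - tauto.
  - tauto.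
  - now rewrite !tsubst_comp.
  - now rewrite IHA, IHB.
  - split; apply not_forced_imp; intros q g _ [HA HB];
      (split; [revert HA|revert HB]); apply not_forced_imp; intros r k _;
      rewrite ?IHA, ?IHB, <- !tcomp_assoc; trivial.
  - split; apply not_forced_imp; intros q g _; apply not_forced_imp;
      intros r k _ [t Ht]; exists t; revert Ht;
      rewrite IHA, env_app_up, <- !tcomp_assoc; trivial.
  - split; intros H q g ts Hg; specialize (H q g ts Hg); revert H;
      rewrite IHA, IHB, !env_app_up, <- !tcomp_assoc; trivial.
Qed.

Lemma force_inst_block A n ts p f :
  force (inst_block n ts A) p f <-> force A p (env_app n (tcomp f ts) f).
Proof.
  rewrite inst_block_env, force_subst, tcomp_env_app. reflexivity.
Qed.

Lemma force_lift A n ts p f :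
  force (lift n A) p (env_app n ts f) <-> force A p f.
Proof. rewrite lift_shift, force_subst, env_app_shift. reflexivity. Qed.

Definition env_eq (p : cond) (f g : nat -> term) : Prop :=
  forall x, der p (Eq (f x) (g x)).

Lemma env_eq_mono h q p f g :
  extends h q p -> env_eq p f g -> env_eq q (tcomp h f) (tcomp h g).
Proof. intros Hh E x. exact (der_mono _ _ _ _ Hh (E x)). Qed.

Lemma env_eq_sym p f g : env_eq p f g -> env_eq p g f.
Proof.
  intros E x. generalize (E x). apply der_seq.
  apply seq_ent, ent_or1, ent_sym. eapply ent_and2, ent_hd.
Qed.

Lemma der_refl p t : der p (Eq t t).
Proof. apply seq_ent, ent_or1, ent_refl. Qed.

Lemma der_and p A B : der p A -> der p B -> der p (And A B).
Proof.
  intros HA. apply der_seq. apply seq_ent. eapply ent_or_elim.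
  - eapply ent_seq; [exact HA|]. eapply ent_and1, ent_hd.
  - apply ent_or1, ent_and; [apply ent_hd|]. eapply ent_and2, ent_tl, ent_hd.
  - apply ent_or2, ent_hd.
Qed.

Lemma env_eq_app p n ts f g :
  env_eq p f g -> env_eq p (env_app n ts f) (env_app n ts g).
Proof. intros E x. unfold env_app. ltb_cases; [apply der_refl|apply E]. Qed.

Lemma der_imp p A B : EBA A B -> der p A -> der p B.
Proof.
  intros H. apply der_seq, seq_ent, ent_or1, (ent_seq _ _ _ H).
  eapply ent_and2, ent_hd.
Qed.

Lemma der_tsubst_eq p f g t :
  env_eq p f g -> der p (Eq (tsubst f t) (tsubst g t)).
Proof.
  intros E. induction t as [x| |t IH|s IHs t IHt|s IHs t IHt]; simpl.
  - apply E.
  - apply der_refl.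
  - revert IH. apply der_imp, seq_ent, ent_Succ, ent_hd.
  - generalize (der_and _ _ _ IHs IHt). apply der_imp, seq_ent, ent_Add;
      [eapply ent_and1|eapply ent_and2]; apply ent_hd.
  - generalize (der_and _ _ _ IHs IHt). apply der_imp, seq_ent, ent_Mul;
      [eapply ent_and1|eapply ent_and2]; apply ent_hd.
Qed.

(** Validates the elimination of equality, once instances are read as values of the assignment. *)
Lemma force_env_eq A : forall p f g, env_eq p f g -> force A p f -> force A p g.
Proof.
  induction A as [| |s t|A IHA B IHB|A IHA B IHB|A IHA|n A IHA B IHB];
    cbn [force]; intros p f g E H.
  - exact H.
  - exact H.
  - generalize (der_and _ _ _ (der_and _ _ _ (der_tsubst_eq _ _ _ s E) H)
                  (der_tsubst_eq _ _ _ t E)).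
    apply der_imp, seq_ent.
    apply (ent_eq_trans _ _ (tsubst f t)); [|eapply ent_and2, ent_hd].
    apply (ent_euclid _ (tsubst f s)).
    + eapply ent_and1, ent_and1, ent_hd.
    + eapply ent_and2, ent_and1, ent_hd.
  - split; [apply (IHA p f)|apply (IHB p f)]; tauto.
  - assert (K : forall C, (forall p f g, env_eq p f g -> force C p f -> force C p g) ->
      forall q h, extends h q p -> not_forced (force C) q (tcomp h g) ->
      not_forced (force C) q (tcomp h f)).
    { intros C IH q h Hh. apply not_forced_imp. intros r k Hk. apply IH.
      now apply (env_eq_mono k r q), (env_eq_mono h q p). }
    revert H. apply not_forced_imp. intros q h Hh [HA HB].
    split; [apply (K A)|apply (K B)]; assumption.
  - revert H. apply not_forced_imp. intros q h Hh. apply not_forced_imp.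
    intros r k Hk [t Ht]. exists t. revert Ht. apply IHA, env_eq_app.
    now apply (env_eq_mono k r q), (env_eq_mono h q p).
  - intros q h ts Hh HA. apply (IHB _ (env_app n ts (tcomp h f))).
    + now apply env_eq_app, (env_eq_mono h q p).
    + apply H; [exact Hh|]. revert HA. apply IHA, env_eq_sym, env_eq_app.
      now apply (env_eq_mono h q p).
Qed.

(** Axioms are required to be forced under every assignment because an open axiom stands for its
    universal closure. *)
Lemma force_sound T G A : (forall B, T B -> forall p f, force B p f) ->
  proves T G A ->
  forall p f, (forall B, In B G -> force B p f) -> force A p f.
Proof.
  intros HT H.
  assert (mono : forall G g q p f, extends g q p ->
    (forall B, In B G -> force B p f) -> forall B, In B G -> force B q (tcomp g f)).
  { intros G0 g q p f Hg HG B HB. apply (force_mono B g q p); auto. }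
  assert (lifted : forall n ts G p f, (forall B, In B G -> force B p f) ->
    forall B, In B (map (lift n) G) -> force B p (env_app n ts f)).
  { intros n ts G0 p f HG B HB. apply in_map_iff in HB as [C [<- HC]].
    apply force_lift. auto. }
  assert (cons : forall G C p f, force C p f -> (forall B, In B G -> force B p f) ->
    forall B, In B (C :: G) -> force B p f).
  { intros G0 C p f HC HG B [<-|HB]; auto. }
  induction H as [G A HA|G A HA|G A _ IH| |G A B _ IHA _ IHB|G A B _ IH|G A B _ IH
    |G A B _ IH|G A B _ IH|G A B C _ IH _ IHA _ IHB|G A t _ IH|G A C _ IH _ IHA
    |G n A B _ IH|G n ts A B _ IH _ IHA|G t|G s t A _ IHE _ IHA];
    intros p f HG.
  - now apply HT.
  - now apply HG.
  - apply force_stable. intros q g Hg HA. apply (IH q (tcomp g f)).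
    apply cons; [now apply force_Neg|]. now apply (mono G g q p).
  - exact I.
  - split; auto.
  - now apply IH.
  - now apply IH.
  - intros q g Hg [HA _]. apply (not_forced_elim _ _ _ HA).
    apply (force_mono _ g q p); auto.
  - intros q g Hg [_ HB]. apply (not_forced_elim _ _ _ HB).
    apply (force_mono _ g q p); auto.
  - apply force_stable. intros q g Hg HC. apply (IH p f HG q g Hg).
    assert (HG' := mono G g q p f Hg HG).
    split; intros r h Hh HAB; apply (HC r h Hh); [apply IHA|apply IHB];
      (apply cons; [exact HAB|now apply (mono G h r q)]).
  - intros q g Hg HA. apply (not_forced_elim _ _ _ HA).
    exists (tsubst g (tsubst f t)).
    specialize (IH p f HG). apply (force_mono _ g q p) in IH; [|exact Hg].
    apply force_inst_block in IH.
    replace (tsubst g (tsubst f t)) with (tsubst (tcomp g f) t)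
      by (symmetry; apply tsubst_comp). exact IH.
  - apply force_stable. intros q g Hg HC. apply (IH p f HG q g Hg).
    intros r h Hh [t Ht]. apply (HC r h Hh).
    apply (force_lift C 1 (fun _ => t)). apply IHA.
    apply cons; [exact Ht|]. apply lifted.
    apply (mono G h r q); [exact Hh|]. now apply (mono G g q p).
  - intros q g ts Hg HA. apply IH. apply cons; [exact HA|]. apply lifted.
    now apply (mono G g q p).
  - apply force_inst_block. specialize (IH p f HG p Var (tcomp f ts) (extends_refl p)).
    rewrite tcomp_Var_l in IH. apply IH. apply force_inst_block. now apply IHA.
  - apply der_refl.
  - apply force_inst_block. specialize (IHA p f HG).
    apply force_inst_block in IHA. revert IHA. apply force_env_eq.
    intros x. unfold env_app. ltb_cases; [exact (IHE p f HG)|apply der_refl].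
Qed.

(** * Forcing agrees with derivability on existential formulas *)

Definition Adequate (A : form) : Prop :=
  forall p f, force A p f <-> der p (subst f A).

Lemma der_bad p : der p Bot -> bad p.
Proof.
  intros H. apply (ba_trans _ _ _ _ H), ba_or_elim; [apply ba_bot|apply ba_id].
Qed.

(** The [n] innermost variables of [A] become fresh free variables and act as generic witnesses. *)
Definition add_cond (n : nat) (A : form) (p : cond) : cond :=
  (And (lift n (fst p)) A, lift n (snd p)).

Lemma add_cond_extends n A p : extends (shift n) (add_cond n A p) p.
Proof. split; [apply and_fst|apply ba_id]. Qed.

Lemma add_cond_der n A p : der (add_cond n A p) A.
Proof. apply seq_ent, ent_or1. eapply ent_and2, ent_hd. Qed.

(** Again [A] is added to the refuted side: the new condition excludes [P], so it is contradictory,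
    which is the claim. *)
Lemma der_not_forced p f A (P : cond -> (nat -> term) -> Prop) :
  (forall q g, P q (tcomp g f) -> der q (subst g A)) ->
  not_forced (not_forced P) p f -> der p A.
Proof.
  intros HP H.
  refine (_ (H (fst p, Or A (snd p)) Var _ _)).
  - exact (fun K => K).
  - split; rewrite subst_Var; [apply ba_id|]. apply seq_ent, ent_or2, ent_hd.
  - rewrite tcomp_Var_l. intros r h [_ Hr] HA. apply HP in HA.
    apply (ba_trans _ _ _ _ HA), ba_or_elim; [|apply ba_id].
    eapply ba_or_intro1. exact Hr.
Qed.

Lemma Adequate_And A B : Adequate A -> Adequate B -> Adequate (And A B).
Proof.
  intros HA HB p f. cbn [force subst]. rewrite (HA p f), (HB p f). split.
  - intros [H1 H2]. now apply der_and.
  - intros H. split; revert H; apply der_imp; [apply and_fst|apply and_snd].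
Qed.

Lemma Adequate_Or A B : Adequate A -> Adequate B -> Adequate (Or A B).
Proof.
  intros HA HB p f. split.
  - intros H. apply (der_not_forced p f _ (fun q e => force A q e \/ force B q e)).
    + intros q g. rewrite subst_comp.
      intros [K|K]; [apply HA in K|apply HB in K]; revert K; apply der_imp;
        [eapply ba_or_intro1|eapply ba_or_intro2]; apply ba_id.
    + revert H. apply not_forced_imp. intros q g _ H.
      split; revert H; apply not_forced_imp; auto.
  - intros H q g Hg [H1 H2]. apply (der_mono g q p) in H; [|exact Hg].
    cbn [subst] in H. rewrite !subst_comp in H.
    (* Adding a refuted disjunct to the condition forces it and so gives a contradiction. *)
    assert (K : forall C, Adequate C -> not_forced (force C) q (tcomp g f) ->
      EBA (And (fst q) (subst (tcomp g f) C)) (snd q)).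
    { intros C HC Hn.
      specialize (Hn _ _ (add_cond_extends 0 (subst (tcomp g f) C) q)).
      unfold bad, add_cond in Hn. simpl in Hn.
      rewrite !lift_shift in Hn. change (shift 0) with Var in Hn.
      rewrite !subst_Var in Hn. apply Hn.
      rewrite tcomp_Var_l. apply HC.
      apply seq_ent, ent_or1. eapply ent_and2, ent_hd. }
    apply der_bad. revert H. apply der_seq, seq_ent, ent_or2.
    eapply ent_or_elim; [eapply ent_and2, ent_hd| |].
    + eapply ent_seq; [exact (K A HA H1)|].
      apply ent_and; [eapply ent_tl, ent_and1|]; apply ent_hd.
    + eapply ent_seq; [exact (K B HB H2)|].
      apply ent_and; [eapply ent_tl, ent_and1|]; apply ent_hd.
Qed.

Lemma env_app_0_shift f :
  env_app 1 (fun _ => Var 0) (tcomp (shift 1) f) = up 1 f.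
Proof. extensionality x. now destruct x. Qed.

Lemma Adequate_Ex A : Adequate A -> Adequate (Ex A).
Proof.
  intros HA p f. split.
  - intros H. refine (der_not_forced p f _ _ _ H). intros q g [t Ht].
    apply HA in Ht. revert Ht. apply der_imp.
    rewrite subst_comp. cbn [subst].
    eapply ba_trans; [|apply (ex_intro_seq t)].
    rewrite inst_env, subst_comp, env_app_up, tcomp_Var_l. apply ba_id.
  - intros H q g Hg Hn. apply (der_mono g q p) in H; [|exact Hg].
    rewrite subst_comp in H. cbn [subst] in H.
    (* The witness is the fresh variable of the extended condition. *)
    specialize (Hn _ _ (add_cond_extends 1 (subst (up 1 (tcomp g f)) A) q)).
    apply der_bad. revert H. apply der_seq, seq_ent, ent_or2.
    eapply ent_ex_elim; [eapply ent_and2, ent_hd|].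
    eapply ent_seq; [apply Hn|].
    + exists (Var 0). rewrite env_app_0_shift. apply HA, add_cond_der.
    + apply ent_and; [|apply ent_hd].
      apply ent_tl. exact (ent_and1 _ _ _ (ent_hd _ _)).
Qed.

(** The universal formula is tested at the generic extension, with fresh variables for the block and
    [A] added. *)
Lemma force_All_der n A B p f : Adequate A -> Adequate B ->
  force (All n A B) p f ->
  EBA (And (lift n (fst p)) (subst (up n f) A))
      (Or (subst (up n f) B) (lift n (snd p))).
Proof.
  intros HA HB H.
  specialize (H _ _ Var (add_cond_extends n (subst (up n f) A) p)).
  rewrite <- up_env_app in H.
  exact (proj1 (HB _ _) (H (proj2 (HA _ _) (add_cond_der _ _ _)))).
Qed.

Lemma subst_env_app_inst n ts f A :
  subst (env_app n ts f) A = inst_block n ts (subst (up n f) A).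
Proof. now rewrite inst_block_env, subst_comp, env_app_up, tcomp_Var_l. Qed.

(** Introducing [All] past a side formula [D] is a classical step. The last hypothesis isolates it,
    to be supplied by decidability; the converse is modus ponens for the stable [B]. *)
Lemma Adequate_All n A B : Adequate A -> Adequate B -> Stable B ->
  (forall f C D,
     EBA (And (lift n C) (subst (up n f) A)) (Or (subst (up n f) B) (lift n D)) ->
     EBA C (Or (subst f (All n A B)) D)) ->
  Adequate (All n A B).
Proof.
  intros HA HB SB Hint p f. split.
  - intros H. apply Hint. now apply force_All_der.
  - intros H q g ts Hg HqA. apply HA in HqA. apply HB.
    apply (der_mono g q p) in H; [|exact Hg]. rewrite subst_comp in H.
    rewrite subst_env_app_inst in *. generalize (der_and _ _ _ H HqA).
    apply der_imp, seq_ent. eapply ent_all_elim.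
    + now apply Stable_subst.
    + eapply ent_and1, ent_hd.
    + eapply ent_and2, ent_hd.
Qed.

(** Decide [A]: if it holds, the premise gives [B] or [D]; if not, the implication holds
    vacuously. *)
Lemma Adequate_Imp A B :
  Adequate A -> Adequate B -> Dec A -> Dec B -> Adequate (Imp A B).
Proof.
  intros HA HB DA DB. apply Adequate_All; [assumption..|now apply Dec_Stable|].
  intros f C D. rewrite up_0, !lift_shift. change (shift 0) with Var.
  rewrite !subst_Var. change (All 0 A B) with (Imp A B). rewrite subst_Imp.
  intros H. apply seq_ent. apply (ent_dec _ _ _ (Dec_subst f A DA)).
  - eapply ent_or_elim.
    + eapply ent_seq; [exact H|]. apply ent_and; [apply ent_tl|]; apply ent_hd.
    + apply ent_or1, ent_imp, ent_tl, ent_hd.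
    + apply ent_or2, ent_hd.
  - apply ent_or1, ent_imp, ent_bot.
    eapply ent_neg_elim; [apply ent_tl|]; apply ent_hd.
Qed.

(** At a counterexample the premise leaves only [D]; otherwise the universal formula holds. *)
Lemma Adequate_All_1 A B : Adequate A -> Adequate B -> Stable B ->
  EBA Top (Or (Ex (And A (Neg B))) (All 1 A B)) -> Adequate (All 1 A B).
Proof.
  intros HA HB SB HAB. apply Adequate_All; trivial.
  intros f C D H. apply (ba_subst _ f) in HAB. cbn [subst] in HAB |- *.
  rewrite subst_Neg in HAB. apply seq_ent.
  eapply ent_or_elim; [apply ent_thm; exact HAB| |apply ent_or1, ent_hd].
  apply ent_or2. eapply ent_ex_elim; [apply ent_hd|].
  eapply ent_or_elim.
  - eapply ent_seq; [exact H|]. apply ent_and.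
    + apply ent_hyp. simpl. tauto.
    + eapply ent_and1, ent_hd.
  - apply ent_bot. eapply ent_neg_elim; [|apply ent_hd].
    eapply ent_and2, ent_tl, ent_hd.
  - apply ent_hd.
Qed.

Lemma Adequate_Eq s t : Adequate (Eq s t).
Proof. intros p f. reflexivity. Qed.

Lemma Adequate_Lt s t : Adequate (Lt s t).
Proof. apply Adequate_Ex, Adequate_Eq. Qed.

Lemma Delta0_Adequate A : Delta0 A -> Adequate A.
Proof.
  induction 1 as [A HA| | |A B HA IHA HB IHB|s A HA IHA|s A HA IHA].
  - destruct HA; intros p f; cbn [force subst]; [|split|reflexivity].
    + split; trivial. intros _. apply seq_ent, ent_or1, ba_top.
    + intros H. apply seq_ent, ent_or2. eapply ent_seq; [exact H|apply ent_hd].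
    + apply der_bad.
  - now apply Adequate_And.
  - now apply Adequate_Or.
  - apply Adequate_Imp; auto using Delta0_Dec.
  - apply Adequate_Ex, Adequate_And; [apply Adequate_Lt|exact IHA].
  - apply Delta0_Dec in HA. apply Adequate_All_1; trivial.
    + apply Adequate_Lt.
    + now apply Dec_Stable.
    + now apply bounded_All_dichotomy.
Qed.

Lemma Sigma1_Adequate A : Sigma1 A -> Adequate A.
Proof. induction 1; auto using Delta0_Adequate, Adequate_Ex. Qed.

(** * The axioms are forced *)

Lemma Adequate_subst h A : Adequate A -> Adequate (subst h A).
Proof. intros HA p f. rewrite force_subst, subst_comp. apply HA. Qed.

Lemma replace_lift t A : replace 0 t (lift 1 A) = lift 1 A.
Proof. unfold replace. rewrite !lift_shift, subst_comp. reflexivity. Qed.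

Lemma subst_up_replace f A :
  subst (up 1 f) (replace 0 (Succ (Var 0)) A) =
  replace 0 (Succ (Var 0)) (subst (up 1 f) A).
Proof.
  unfold replace. rewrite !subst_comp. f_equal. extensionality x.
  unfold tcomp. destruct x; simpl; [reflexivity|].
  unfold up. simpl. unfold tlift. rewrite tsubst_comp. reflexivity.
Qed.

Lemma force_induction A p f : Adequate A -> force (induction A) p f.
Proof.
  intros HA q g ts Hg. rewrite env_app_0. generalize (tcomp g f). clear g ts Hg f p.
  intros f [H0 HS] p g ts Hg _.
  apply (force_mono _ g p q) in H0; [|exact Hg].
  apply (force_mono _ g p q) in HS; [|exact Hg].
  revert H0 HS. generalize (tcomp g f). clear g q Hg f. intros f H0 HS.
  (* With [p = (C, D)], the induction step becomes the sequent [C /\ A => A[x/Sx] \/ D]. *)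
  apply force_All_der in HS; [|exact HA|now apply Adequate_subst].
  apply HA. rewrite subst_env_app_inst.
  apply Adequate_subst in H0; [|exact HA].
  change (der p (subst f (inst_block 1 (fun _ => Zero) A))) in H0.
  rewrite subst_inst_block in H0.
  change (tcomp f (fun _ => Zero)) with (fun _ : nat => Zero) in H0.
  rewrite subst_up_replace in HS. revert H0 HS.
  generalize (subst (up 1 f) A). clear A HA f. intros A H0 HS.
  (* The lifted [C] and [D] are free of the induction variable, so replacement only touches [A], and
     the disjunct [D] passes through the step unchanged. *)
  set (X := And (lift 1 (fst p)) (Or A (lift 1 (snd p)))).
  assert (HX : EBA (replace 0 Zero X) X).
  { apply ba_ind_rule. unfold X.
    change (EBA X (And (replace 0 (Succ (Var 0)) (lift 1 (fst p)))
      (Or (replace 0 (Succ (Var 0)) A) (replace 0 (Succ (Var 0)) (lift 1 (snd p)))))).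
    rewrite !replace_lift. apply ba_and_intro; [apply and_fst|].
    apply seq_ent. eapply ent_or_elim; [eapply ent_and2, ent_hd| |].
    - eapply ent_seq; [exact HS|].
      apply ent_and; [|apply ent_hd]. eapply ent_and1, ent_tl, ent_hd.
    - apply ent_or2, ent_hd. }
  apply (ba_subst _ (env_app 1 ts Var)) in HX.
  rewrite replace_Zero in HX.
  change (EBA (inst_block 1 ts (lift 1 (inst Zero X)))
    (And (inst_block 1 ts (lift 1 (fst p)))
       (Or (inst_block 1 ts A) (inst_block 1 ts (lift 1 (snd p)))))) in HX.
  rewrite !inst_block_lift in HX.
  eapply ba_trans; [|eapply ba_and_elim2; exact HX].
  change (EBA (fst p) (And (inst Zero (lift 1 (fst p)))
    (Or (inst Zero A) (inst Zero (lift 1 (snd p)))))).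
  unfold inst. rewrite !inst_block_lift.
  apply ba_and_intro; [apply ba_id|exact H0].
Qed.

Lemma force_thm A : Adequate A -> EBA Top A -> forall p f, force A p f.
Proof.
  intros HA H p f. apply HA, seq_ent, ent_or1, ent_thm.
  exact (ba_subst _ f _ _ H).
Qed.

Lemma force_Q A p f : Q A -> force A p f.
Proof.
  intros H. apply force_thm.
  - destruct H; try apply Adequate_Eq;
      try (apply Delta0_Adequate, Delta0_Imp; repeat constructor).
    (* The predecessor axiom has an unbounded [Ex] under an [Or], so it is not literally [Sigma1],
       but it is adequate all the same. *)
    apply Adequate_Or; [|apply Adequate_Ex]; apply Adequate_Eq.
  - now apply EBA_Q.
Qed.

Lemma ISigma1_conservative A B : Sigma1 A -> Sigma1 B ->
  proves ISigma1 [] (Imp A B) -> EBA A B.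
Proof.
  intros HA HB H. apply Sigma1_Adequate in HA, HB.
  assert (HT : forall C, ISigma1 C -> forall p f, force C p f).
  { intros C [D HD|D HD] p f; [now apply force_Q|].
    now apply force_induction, Sigma1_Adequate. }
  (* Under the identity assignment the free variables of [A] and [B] denote themselves; the forced
     implication is then used at [(A, B)] itself. *)
  assert (K := force_sound _ _ _ HT H (A, B) Var ltac:(easy) (A, B) Var Var
    (extends_refl _)).
  rewrite tcomp_Var_l, env_app_0 in K.
  assert (HAB : der (A, B) B).
  { rewrite <- (subst_Var B) at 2. apply HB, K, HA. rewrite subst_Var.
    apply seq_ent, ent_or1, ent_hd. }
  apply (ba_trans _ _ _ _ HAB), ba_or_elim; apply ba_id.
Qed.

Theorem theorem4p22 :
  (forall A B : form, Sigma1 A -> Sigma1 B ->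
     proves ISigma1 [] (Imp A B) -> EBA A B) /\
  (forall A B : form, Delta0 A -> Delta0 B ->
     proves PA [] (Imp A B) -> EBA A B).
Proof.
  split; [exact ISigma1_conservative|exact PA_conservative].
Qed.
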